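(* Let $d\ge 2$ and let $y_1,\ldots,y_n\in\mathbb{R}^d$ be in type $B$ general position. Then for all $k=1,\ldots,d$ the number of $k$-dimensional faces of the Weyl tessellation of type $B_n$ is $$\#\mathcal{F}^B_k(y_1,\ldots,y_n)=B\{n,n-d+k\}\,D^B(n-d+k,k),$$ where the numbers $B\{n,k\}$ are given by $$B\{n,k\}=\sum_{r=k}^n\binom{n}{r}\genfrac{\{}{\}}{0pt}{}{r}{k}2^{r-k}.$$
   Context: Type $B$ general position: vectors $y_1,\ldots,y_n\in\mathbb{R}^d$ are said to be in type $B$ general position if $n\ge d$ and, for every $\varepsilon=(\varepsilon_1,\ldots,\varepsilon_n)\in\{\pm1\}^n$ and every permutation $\sigma$ of $\{1,\ldots,n\}$, any $d$ of the vectors $\varepsilon_1y_{\sigma(1)}-\varepsilon_2y_{\sigma(2)},\ldots,\varepsilon_{n-1}y_{\sigma(n-1)}-\varepsilon_ny_{\sigma(n)},\,\varepsilon_ny_{\sigma(n)}$ are linearly independent. For $x\in\mathbb{R}^d\setminus\{0\}$ let $x^\perp=\{v\in\mathbb{R}^d:\langle v,x\rangle=0\}$. The Weyl tessellation $\mathcal{W}^B(y_1,\ldots,y_n)$ of type $B_n$ is the set of cones obtained as closures of the connected components of the complement in $\mathbb{R}^d$ of the union of the hyperplanes $(y_i+y_j)^\perp$ and $(y_i-y_j)^\perp$ for $1\le i<j\le n$, and $y_i^\perp$ for $1\le i\le n$. For a polyhedral cone $C$ (finite intersection of closed half-spaces whose boundaries pass through the origin), $\mathcal{F}_k(C)$ is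 the set of its $k$-dimensional faces, where faces are obtained by replacing some (possibly none) of the half-spaces defining $C$ by their boundaries; dimension is the dimension of the linear hull. The set of $k$-faces of the tessellation is $\mathcal{F}^B_k(y_1,\ldots,y_n)=\bigcup_{C\in\mathcal{W}^B(y_1,\ldots,y_n)}\mathcal{F}_k(C)$. $\genfrac{\{}{\}}{0pt}{}{r}{k}$ is the Stirling number of the second kind (number of partitions of $\{1,\ldots,r\}$ into $k$ non-empty subsets). The numbers $B[n,k]$ are defined by $(t+1)(t+3)\cdots(t+2n-1)=\sum_{k=0}^nB[n,k]\,t^k$, with $B[n,k]=0$ for $k\notin\{0,\ldots,n\}$, and $D^B(m,k):=2\sum_{i\ge 0}B[m,m-k+1+2i]$. *)

(* Defs.v *)
From HB Require Import structures.
From mathcomp Require Import all_boot all_order all_algebra all_fingroup.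
From mathcomp Require Import all_classical all_reals all_analysis.

Set Implicit Arguments.
Unset Strict Implicit.
Unset Printing Implicit Defensive.

Import Order.TTheory GRing.Theory Num.Theory.
Import numFieldNormedType.Exports.

Local Open Scope classical_set_scope.
Local Open Scope ring_scope.

Definition dot (R : realType) (d : nat) (u v : 'rV[R]_d) : R :=
  \sum_(i < d) u 0 i * v 0 i.

Definition perp (R : realType) (d : nat) (x : 'rV[R]_d) : set 'rV[R]_d :=
  [set v | dot v x = 0].

Definition halfspace (R : realType) (d : nat) (x : 'rV[R]_d) : set 'rV[R]_d :=
  [set v | 0 <= dot v x].

(* The sign eps_i is encoded as (-1) ^+ eps i. For i < n the i-th vector is
   eps_i y_(s i) - eps_(i+1) y_(s (i+1)); for the last index [insub] fails and
   the vector is eps_n y_(s n). *)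
Definition typeB_vector (R : realType) (d n : nat) (y : 'I_n -> 'rV[R]_d)
    (eps : 'I_n -> bool) (s : 'S_n) (i : 'I_n) : 'rV[R]_d :=
  let z j := (-1) ^+ eps j *: y (s j) in
  if (insub i.+1 : option 'I_n) is Some j then z i - z j else z i.

(* "Any d of the vectors" is read in terms of indices, i.e. the vectors are
   taken as an indexed family. *)
Definition typeB_general_position (R : realType) (d n : nat)
    (y : 'I_n -> 'rV[R]_d) : Prop :=
  (d <= n)%N /\
  forall (eps : 'I_n -> bool) (s : 'S_n) (I : {set 'I_n}), #|I| = d ->
    free [seq typeB_vector y eps s i | i <- enum I].

Definition typeB_arrangement (R : realType) (d n : nat)
    (y : 'I_n -> 'rV[R]_d) : set 'rV[R]_d :=
  \bigcup_(p in [set p : 'I_n * 'I_n | (p.1 < p.2)%N])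
     (perp (y p.1 + y p.2) `|` perp (y p.1 - y p.2))
  `|` \bigcup_(i in [set: 'I_n]) perp (y i).

Definition weyl_tessellation (R : realType) (d n : nat)
    (y : 'I_n -> 'rV[R]_d) : set (set 'rV[R]_d) :=
  [set closure (connected_component (~` typeB_arrangement y) x)
     | x in ~` typeB_arrangement y].

Definition is_linear_hull (R : realType) (d : nat) (A : set 'rV[R]_d)
    (U : {vspace 'rV[R]_d}) : Prop :=
  (forall v, A v -> v \in U) /\
  forall W : {vspace 'rV[R]_d}, (forall v, A v -> v \in W) -> (U <= W)%VS.

Definition has_dim (R : realType) (d : nat) (A : set 'rV[R]_d) (k : nat) :
    Prop :=
  exists2 U : {vspace 'rV[R]_d}, is_linear_hull A U & \dim U = k.

(* The faces of a polyhedral cone do not depend on the half-spaces chosen to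
   represent it, so the representation is quantified existentially. *)
Definition faces (R : realType) (d k : nat) (C : set 'rV[R]_d) :
    set (set 'rV[R]_d) :=
  [set F | has_dim F k /\
    exists (m : nat) (a : 'I_m -> 'rV[R]_d) (I : {set 'I_m}),
      [/\ forall i, a i != 0,
          C = \bigcap_(i in [set: 'I_m]) halfspace (a i) &
          F = \bigcap_(i in [set: 'I_m])
                (if i \in I then perp (a i) else halfspace (a i))]].

Definition tessellation_faces (R : realType) (d n k : nat)
    (y : 'I_n -> 'rV[R]_d) : set (set 'rV[R]_d) :=
  \bigcup_(C in weyl_tessellation y) faces k C.

Definition stirling2 (r k : nat) : nat :=
  #|[pred P : {set {set 'I_r}} | finset.partition P finset.setT & #|P| == k]|.

Definition typeB_stirling2 (n k : nat) : nat :=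
  (\sum_(k <= r < n.+1) 'C(n, r) * stirling2 r k * 2 ^ (r - k))%N.

(* B[n, k], with k an integer so that it vanishes for k < 0. *)
Definition typeB_stirling1 (n : nat) (k : int) : nat :=
  if k is Posz j then
    ((\prod_(i < n) ('X + (2 * i + 1)%N%:P) : {poly nat})`_j)%R
  else 0%N.

(* The terms with i > k vanish, because then m - k + 1 + 2 i > m. *)
Definition DB (m k : nat) : nat :=
  (2 * \sum_(i < k.+1)
         typeB_stirling1 m (m%:Z - k%:Z + 1 + (2 * i)%N%:Z)%R)%N.

(* Main.v *)
Require Import Defs.
From mathcomp Require Import all_boot all_order all_algebra all_fingroup.
From mathcomp Require Import all_classical all_reals all_analysis.
From mathcomp Require finmap.
From mathcomp Require Import zify ring lra.

(** Why the count holds. Record a point x of R^d by the numbers <x, y_i>. The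
    faces of the tessellation are the closed cones [cone a x] cut out by the
    signs at x of the normals y_i, y_i - y_j, y_i + y_j, and the linear hull of
    [cone a x] is the subspace [flat a x] where the normals vanishing at x
    vanish ([facesP], [faces_cone], [cone_dim], after the chambers have been
    identified in [weyl_tessellationE]). So faces are counted as sign patterns
    of points.

    Choose one vector for each nonzero value of |<x, y_i>|; let T be the list of
    these representatives. Every other y_i agrees with 0 or with plus or minus a
    representative on the flat of x. General position says that each such
    coincidence costs one dimension, so the flat has dimension d - (n - |T|),
    and the k-faces are those with |T| = m := n - d + k. It remains to count
    the pairs (flat with m representatives, chamber of the arrangement induced on
    that flat).

    Flats are counted by scanning the vectors: a new vector either becomes a
    representative or attaches to one of the 2 |T| + 1 elements of
    {0} u T u -T. This gives the number [flat_ext m n 0], which satisfies the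
    recursion of B{n, m} ([typeB_stirling2_flat_ext]). On a flat, the
    arrangement is of type B_m, generated by T, in general position with
    respect to a space of dimension k. Adding one vector z to a list T of m
    vectors adds 2m + 1 hyperplanes z = q, q in {0} u T u -T. Adding them one
    at a time, each cuts as many chambers in two as there are chambers in its
    trace, and on the trace z = q all the other new hyperplanes z = q' become
    hyperplanes q = q' of the old arrangement. Hence the number of chambers
    obeys r(m + 1, k + 1) = r(m, k + 1) + (2m + 1) r(m, k), which is the
    recursion [DB_rec] of D^B ([card_regions_arr]). The product is assembled in
    [card_stratum].

    Both inductions need a notion of general position that passes to sublists
    and to sections by hyperplanes z = q. This is [gen_pos]: for every signed
    reordering, any collection of the chain vectors of the definition cuts the
    ambient space in the expected dimension. It is stable because a
    hyperplane y = q can be traded for a link of a longer chain, by inserting y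
    just before q ([chain_insert]). *)

Set Implicit Arguments.
Unset Strict Implicit.
Unset Printing Implicit Defensive.
Import Order.TTheory GRing.Theory Num.Theory.
Import numFieldNormedType.Exports.
Local Open Scope classical_set_scope.
Local Open Scope ring_scope.

(** * The numbers B[n, k] and D^B *)

(** Multiplication by the last factor t + (2m + 1). *)
Lemma typeB_stirling1_rec m (j : int) :
  typeB_stirling1 m.+1 j =
  (typeB_stirling1 m (j - 1) + (2 * m + 1) * typeB_stirling1 m j)%N.
Proof.
case: j => [j|j]; last first.
  by rewrite (_ : Negz j - 1 = Negz j.+1) //=; lia.
have -> : typeB_stirling1 m.+1 j%:Z = (typeB_stirling1 m j * (2 * m + 1) +
    if j is i.+1 then typeB_stirling1 m i else 0)%N.
  by rewrite /= big_ord_recr /= mulrDr addrC coefD coefMX coefMC; case: j.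
case: j => [|j]; first by rewrite addn0 mulnC.
by rewrite (_ : j.+1%:Z - 1 = j%:Z); [rewrite addnC mulnC | lia].
Qed.

Lemma typeB_stirling1_out m (j : int) : (m%:Z < j)%R -> typeB_stirling1 m j = 0%N.
Proof.
elim: m j => [|m IH] j hj; last by rewrite typeB_stirling1_rec !IH ?muln0 //; lia.
case: j hj => // -[] //= j _.
by rewrite big_ord0 coefC.
Qed.

(** Apply the recursion of B[m + 1, j] to each term. The shift j - 1 turns the
    index m + 1 - (k + 1) + 1 + 2i into the one of D^B(m, k + 1), and the other
    summand is D^B(m, k); the extra index i = k + 1 contributes nothing. *)
Lemma DB_rec m k : DB m.+1 k.+1 = (DB m k.+1 + (2 * m + 1) * DB m k)%N.
Proof.
rewrite /DB mulnCA -mulnDr; congr (2 * _)%N.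
rewrite (eq_bigr (fun i : 'I_k.+2 =>
   typeB_stirling1 m (m%:Z - k.+1%:Z + 1 + (2 * i)%N%:Z) +
   (2 * m + 1) * typeB_stirling1 m (m%:Z - k%:Z + 1 + (2 * i)%N%:Z)))%N.
  rewrite big_split /=; congr (_ + _)%N.
  rewrite -big_distrr /=; congr (_ * _)%N; rewrite big_ord_recr /=.
  by rewrite typeB_stirling1_out ?addn0 //; lia.
move=> i _; rewrite typeB_stirling1_rec;
  congr (typeB_stirling1 _ _ + _ * typeB_stirling1 _ _)%N; lia.
Qed.

Lemma DB_S0 m : DB m.+1 0 = 0%N.
Proof. by rewrite /DB big_ord1 typeB_stirling1_out //; lia. Qed.

(** Exactly one of the indices 1 - k + 2i lies in {0, 1}, where the coefficients of
    t + 1 are 1. The induction on the number of vectors starts here: the empty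
    arrangement has one chamber, whereas D^B(0, k) is 2 or 0 according to the
    parity of k. *)
Lemma DB_1S k : DB 1 k.+1 = 2.
Proof.
have b1 (j : int) : typeB_stirling1 1 j = ((j == 0) || (j == 1)).
  case: j => [j|j] //=; rewrite big_ord1 coefD coefX coefC.
  by case: j => [|[|]].
(* The index in question has i = k./2. *)
rewrite /DB (bigD1 (inord k./2)) //= big1 ?addn0 => [|i ik].
  rewrite b1 inordK; last by lia.
  by rewrite (_ : _ || _) //; lia.
rewrite b1; move: ik; rewrite -val_eqE /= inordK; last by lia.
by move=> ik; rewrite (_ : _ || _ = false) //; lia.
Qed.

(** * Stirling numbers of the second kind *)

Section Stirling.
Local Open Scope nat_scope.
Local Open Scope set_scope.
Variable T : finType.
Implicit Types (A B C : {set T}) (P Q : {set {set T}}) (x : T).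

Definition set_parts A k := [set P | finset.partition P A & #|P| == k]%SET.

Lemma notin_block P A B x : finset.partition P A -> x \notin A -> B \in P -> x \notin B.
Proof. by move=> pP xA BP; apply: contra xA; apply/fintype.subsetP/(partitionS pP). Qed.

(** Partitions of x |: A in which x is alone: delete its block. *)
Lemma set_parts_singleton A x k : x \notin A ->
  [set P in set_parts (x |: A) k.+1 | [set x] \in P]%SET =
  [set ([set x] |: P)%SET | P in set_parts A k]%SET.
Proof.
move=> xA; apply/finset.setP => Q; rewrite !inE; apply/andP/imsetP.
- case=> /andP[pQ /eqP cQ] xQ; exists (Q :\ [set x])%SET; last by rewrite finset.setD1K.
  rewrite inE; have := partitionD1 pQ xQ.
  rewrite finset.setU1K // => -> /=.
  by have := finset.cardsD1 [set x]%SET Q; rewrite xQ cQ => -[->].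
- case=> P; rewrite inE => /andP[pP /eqP cP] ->; rewrite finset.setU11; split=> //.
  rewrite finset.cardsU1 cP (_ : [set x]%SET \notin P) ?add1n ?eqxx ?andbT.
    apply: partitionU1 => //; first by apply/finset.set0Pn; exists x; rewrite inE.
    by rewrite disjoints1.
  by apply: contra xA => /(partitionS pP)/fintype.subsetP; apply; rewrite inE.
Qed.

(** Partitions of x |: A in which x is not alone correspond to a partition P of A
    together with the block C of P that x joins. *)
Lemma set_parts_enlarged A x k : x \notin A ->
  [set P in set_parts (x |: A) k | [set x] \notin P]%SET =
  [set ((x |: u.2) |: (u.1 :\ u.2))%SET | u : {set {set T}} * {set T} in
     [set u | (u.1 \in set_parts A k) && (u.2 \in u.1)]]%SET.
Proof.
move=> xA; apply/finset.setP => Q; rewrite !inE; apply/andP/imsetP.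
- case=> /andP[pQ /eqP cQ] xQ.
  have xcov : x \in finset.cover Q by rewrite (cover_partition pQ) finset.setU11.
  pose D := finset.pblock Q x.
  have DQ : D \in Q by rewrite pblock_mem.
  have xD : x \in D by rewrite mem_pblock.
  have pD := partitionD1 pQ DQ.
  have ND : (D :\ x)%SET \notin (Q :\ D)%SET.
    apply/negP => /[dup] h; move/(partitionS pD)/fintype.subsetP.
    have /finset.set0Pn[z zD] := partition_neq0 pD h.
    by move=> /(_ _ zD); rewrite !inE in zD *; case/andP: zD => _ ->.
  exists ((D :\ x) |: (Q :\ D), D :\ x)%SET => /=; last first.
    by rewrite finset.setD1K // finset.setU1K // finset.setD1K.
  rewrite inE /= finset.setU11 andbT inE finset.cardsU1 ND.
  have := finset.cardsD1 D Q; rewrite DQ cQ => ->; rewrite eqxx andbT.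
  have -> : A = ((D :\ x) :|: ((x |: A) :\: D))%SET.
    have /fintype.subsetP sD := partitionS pQ DQ.
    apply/finset.setP => z; have := sD z; rewrite !inE.
    case: (eqVneq z x) => [->|zx] /=; first by rewrite (negPf xA) xD.
    by case: (z \in D) => //= ->.
  apply: partitionU1 => //.
    apply: contra xQ; rewrite finset.setD_eq0 finset.subset1 => /orP[/eqP<- //|/eqP D0].
    by move: xD; rewrite D0 inE.
  rewrite -setI_eq0; apply/eqP/finset.setP => z; rewrite !inE.
  by case: (z \in D); rewrite /= ?andbF.
- case=> -[P C] /=; rewrite !inE /= => /andP[/andP[pP /eqP cP] CP] ->.
  have pD := partitionD1 pP CP.
  have xC := notin_block pP xA CP.
  have N : (x |: C)%SET \notin (P :\ C)%SET.
    by apply/negP => h; have := notin_block pP xA (_ : x |: C \in P)%SET;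
       rewrite finset.setU11; move: h; rewrite inE => /andP[_ ->] /(_ isT).
  split.
    rewrite finset.cardsU1 N -cP (finset.cardsD1 C P) CP eqxx andbT.
    have -> : (x |: A)%SET = ((x |: C) :|: (A :\: C))%SET.
      have /fintype.subsetP sC := partitionS pP CP.
      apply/finset.setP => z; have := sC z; rewrite !inE.
      by case: (z \in C) => [->|] //=; rewrite ?orbT ?orbF //=; case: eqP.
    apply: partitionU1 => //; first by apply/finset.set0Pn; exists x; rewrite finset.setU11.
    rewrite -setI_eq0; apply/eqP/finset.setP => z; rewrite !inE.
    case: (eqVneq z x) => [->|_] /=; first by rewrite (negPf xA) andbF.
    by case: (z \in C).
  rewrite !inE negb_or; apply/andP; split.
    have /finset.set0Pn[z zC] := partition_neq0 pP CP.
    apply/negP => /eqP/finset.setP/(_ z); rewrite !inE zC orbT => /eqP zx.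
    by move: xC; rewrite -zx zC.
  apply/negP => /andP[_ /(notin_block pP xA)]; by rewrite inE eqxx.
Qed.

(** The recursion is proved over an arbitrary finite set, so that the number of
    partitions of A is seen to depend on #|A| alone. *)
Lemma card_set_parts_rec A x k : x \notin A ->
  #|set_parts (x |: A)%SET k.+1| = #|set_parts A k| + k.+1 * #|set_parts A k.+1|.
Proof.
move=> xA.
rewrite -(finset.cardsID [set P : {set {set T}} | [set x]%SET \in P]%SET).
congr (_ + _).
  rewrite -(card_in_imset (f := fun P => ([set x] |: P)%SET) (D := mem (set_parts A k))).
    rewrite -set_parts_singleton //; apply: eq_card => P; by rewrite !inE andbC.
  move=> P Q; rewrite !inE => /andP[pP _] /andP[pQ _] e.
  have N R : finset.partition R A -> [set x]%SET \notin R.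
    by move=> pR; apply/negP => /(notin_block pR xA); rewrite inE eqxx.
  by rewrite -(finset.setU1K (N _ pP)) e finset.setU1K ?N.
transitivity #|[set u : {set {set T}} * {set T} |
   (u.1 \in set_parts A k.+1) && (u.2 \in u.1)]%SET|.
  rewrite -(card_in_imset (f := fun u => ((x |: u.2) |: (u.1 :\ u.2))%SET)).
    rewrite -set_parts_enlarged //; apply: eq_card => P; by rewrite !inE andbC.
  move=> [P C] [Q D]; rewrite !inE /= => /andP[/andP[pP _] CP] /andP[/andP[pQ _] DQ] e.
  have xC := notin_block pP xA CP; have xD := notin_block pQ xA DQ.
  have e1 R E F : finset.partition R A -> E \in R ->
      (F \in ((x |: E) |: (R :\ E))%SET) && (x \in F) = (F == x |: E)%SET.
    move=> pR ER; rewrite !inE; case: eqVneq => [->|_] /=; first by rewrite finset.setU11.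
    by apply/negP => /andP[/andP[_ /(notin_block pR xA) /negP]].
  have ECD : (x |: C = x |: D)%SET.
    by apply/eqP; rewrite -(e1 _ _ _ pQ DQ) -e e1.
  have CD : C = D by rewrite -(finset.setU1K xC) ECD finset.setU1K.
  subst D; congr (_, _).
  have N2 R : finset.partition R A -> (x |: C)%SET \notin (R :\ C)%SET.
    move=> pR; apply/negP; rewrite inE => /andP[_ /(notin_block pR xA)].
    by rewrite finset.setU11.
  by rewrite -(finset.setD1K CP) -(finset.setU1K (N2 _ pP)) e finset.setU1K ?N2 // finset.setD1K.
rewrite -sum1_card (eq_bigl (fun u : {set {set T}} * {set T} =>
   (u.1 \in set_parts A k.+1) && (u.2 \in u.1))); last by move=> u; rewrite !inE.
rewrite -(pair_big_dep (mem (set_parts A k.+1)) (fun P C => C \in P) (fun _ _ => 1)) /=.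
under eq_bigr => P do rewrite sum1_card.
rewrite (eq_bigr (fun=> k.+1)) ?sum_nat_const 1?mulnC // => P.
by rewrite inE => /andP[_ /eqP].
Qed.

End Stirling.

Fixpoint stirling (r k : nat) : nat :=
  match r, k with
  | 0, 0 => 1
  | 0, _.+1 => 0
  | _.+1, 0 => 0
  | r.+1, k.+1 => stirling r k + k.+1 * stirling r k.+1
  end%N.

Lemma card_set_parts (T : finType) (A : {set T}) k : #|set_parts A k| = stirling #|A| k.
Proof.
move e : #|A| => r; elim: r A e k => [|r IH] A e k.
  have -> : set_parts A k = if k == 0%N then [set finset.set0]%SET else finset.set0.
    move/eqP: e; rewrite cards_eq0 => /eqP->; apply/finset.setP => P; rewrite !inE partition_set0.
    case: eqP => [->|] /=; first by rewrite cards0 eq_sym; case: eqP; rewrite !inE ?eqxx.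
    by move=> /eqP/negPf P0; case: eqP; rewrite !inE ?P0.
  by case: k => [|k] /=; rewrite ?cards1 ?cards0.
have /finset.set0Pn[x xA] : A != finset.set0 by rewrite -cards_eq0 e.
have cB : #|(A :\ x)%SET| = r by have := finset.cardsD1 x A; rewrite xA e => -[->].
rewrite -(finset.setD1K xA); case: k => [|k].
  apply/eqP; rewrite cards_eq0; apply/eqP/finset.setP => P; rewrite !inE cards_eq0.
  apply/negP => /andP[pP /eqP P0]; have := cover_partition pP.
  by rewrite P0 /finset.cover big_set0 => /finset.setP/(_ x); rewrite !inE eqxx.
by rewrite card_set_parts_rec ?inE ?eqxx // !IH.
Qed.

Lemma stirling2E r k : stirling2 r k = stirling r k.
Proof.
rewrite -[in RHS](card_ord r) -finset.cardsT -card_set_parts /stirling2 cardsE.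
by apply: eq_card => P; rewrite !inE.
Qed.

(** * The numbers B{n, k} *)

Section StirlingB.
Local Open Scope nat_scope.

Lemma stirling_small r k : r < k -> stirling r k = 0.
Proof.
elim: r k => [|r IH] [|k] //= rk; rewrite IH // IH; lia.
Qed.

(** The power of 2 counts the signs of r elements in k blocks, up to one global
    sign per block. *)
Definition weighted_stirling r k := stirling r k * 2 ^ (r - k).

Lemma weighted_stirlingS r k :
  weighted_stirling r.+1 k =
  (if k is j.+1 then weighted_stirling r j else 0) + 2 * k * weighted_stirling r k.
Proof.
case: k => [|k]; rewrite /weighted_stirling //= subSS mulnDl; congr (_ + _).
case: (ltnP r k.+1) => rk; first by rewrite stirling_small // !muln0.
by rewrite (_ : r - k = (r - k.+1).+1) ?expnS; lia.
Qed.

Lemma typeB_stirling2E n k :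
  typeB_stirling2 n k = \sum_(r < n.+1) 'C(n, r) * weighted_stirling r k.
Proof.
rewrite /typeB_stirling2 -(big_mkord xpredT (fun r => 'C(n, r) * weighted_stirling r k)).
under eq_bigr => r _ do rewrite stirling2E -mulnA -/(weighted_stirling r k).
case: (leqP k n.+1) => kn.
  rewrite [RHS](@big_cat_nat _ _ _ k) //= [X in X + _]big_nat_cond [X in X + _]big1 ?add0n // => r.
  by rewrite andbT => /andP[_ rk]; rewrite /weighted_stirling stirling_small // muln0.
rewrite big_geq; last exact: ltnW.
apply/esym; rewrite big_nat_cond big1 // => r /andP[/andP[_ rn] _].
by rewrite /weighted_stirling stirling_small ?muln0 //; lia.
Qed.

(** Pascal's rule splits the sum according to whether the new element lies in the
    zero block. *)
Lemma typeB_stirling2_rec n k :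
  typeB_stirling2 n.+1 k =
  (if k is j.+1 then typeB_stirling2 n j else 0) + (2 * k + 1) * typeB_stirling2 n k.
Proof.
have -> : (if k is j.+1 then typeB_stirling2 n j else 0) =
    \sum_(r < n.+1) 'C(n, r) * (if k is j.+1 then weighted_stirling r j else 0).
  by case: k => [|k]; rewrite ?typeB_stirling2E //; apply/esym/big1 => i _; rewrite muln0.
rewrite mulnDl mul1n addnA !typeB_stirling2E big_distrr -big_split /=.
rewrite (eq_bigr (fun r : 'I_n.+1 => 'C(n, r) * weighted_stirling r.+1 k)); last first.
  by move=> r _; rewrite weighted_stirlingS mulnDr; lia.
rewrite big_ord_recl /= bin0; under eq_bigr => r _ do rewrite /bump add1n binS mulnDl.
rewrite big_split /= addnA addnC; congr (_ + _).
by rewrite big_ord_recr /= bin_small // addn0 [RHS]big_ord_recl bin0.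
Qed.

(** The number of ways of completing t representatives to m by scanning n more
    elements, each of which becomes a representative or attaches to one of the
    2t + 1 values 0, +- representative. *)
Fixpoint flat_ext (m n t : nat) : nat :=
  if n is n'.+1 then (2 * t + 1) * flat_ext m n' t + flat_ext m n' t.+1
  else t == m.

(** [flat_ext] is defined by expanding the first step of a scan of length n + 1;
    expanding the last step instead gives a recursion in m. Both compute powers
    of the same transfer matrix. *)
Lemma flat_ext_rec m n t :
  flat_ext m n.+1 t =
  (if m is j.+1 then flat_ext j n t else 0) + (2 * m + 1) * flat_ext m n t.
Proof.
elim: n t => [|n IH] t.
  case: m => [|m]; first by case: t => [|t] /=; rewrite ?muln0.
  rewrite /= eqSS addnC; congr (_ + _).
  by case: (eqVneq t m.+1) => [->//|_]; rewrite !muln0.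
rewrite [LHS](_ : _ = (2 * t + 1) * flat_ext m n.+1 t + flat_ext m n.+1 t.+1) //.
rewrite [in LHS]IH [in LHS]IH; case: m {IH} => [|m] /=; ring.
Qed.

Lemma typeB_stirling2_flat_ext n m : typeB_stirling2 n m = flat_ext m n 0.
Proof.
elim: n m => [|n IH] m; last first.
  by rewrite typeB_stirling2_rec flat_ext_rec; case: m => [|m]; rewrite !IH.
by rewrite typeB_stirling2E big_ord1 bin0 mul1n; case: m.
Qed.
End StirlingB.

(** * Hyperplane sections and general position *)

Section Dot.
Variables (R : realType) (d : nat).
Implicit Types (u v h : 'rV[R]_d) (U W : {vspace 'rV[R]_d}) (cs : seq 'rV[R]_d).

Lemma dotE u v : dot u v = (u *m v^T) 0 0.
Proof. by rewrite mxE; apply: eq_bigr => i _; rewrite mxE. Qed.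

Lemma dotC u v : dot u v = dot v u.
Proof. by apply: eq_bigr => i _; rewrite mulrC. Qed.

Lemma dotDl u v h : dot (u + v) h = dot u h + dot v h.
Proof. by rewrite !dotE mulmxDl mxE. Qed.

Lemma dotZl (c : R) u h : dot (c *: u) h = c * dot u h.
Proof. by rewrite !dotE -scalemxAl mxE. Qed.

Lemma dotDr u v h : dot h (u + v) = dot h u + dot h v.
Proof. by rewrite ![dot h _]dotC dotDl. Qed.

Lemma dotZr (c : R) u h : dot h (c *: u) = c * dot h u.
Proof. by rewrite ![dot h _]dotC dotZl. Qed.

Lemma dotNr u h : dot h (- u) = - dot h u.
Proof. by rewrite -scaleN1r dotZr mulN1r. Qed.

Lemma dotBr u v h : dot h (u - v) = dot h u - dot h v.
Proof. by rewrite dotDr dotNr. Qed.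

Lemma dotBl u v h : dot (u - v) h = dot u h - dot v h.
Proof. by rewrite ![dot _ h]dotC dotBr. Qed.

Lemma dot0r h : dot h 0 = 0.
Proof. by rewrite -(scale0r 0) dotZr mul0r. Qed.

Lemma dot0l h : dot 0 h = 0.
Proof. by rewrite dotC dot0r. Qed.

Lemma dot_self_eq0 v : dot v v = 0 -> v = 0.
Proof.
move=> /eqP; rewrite psumr_eq0 => [|i _]; last by rewrite -expr2 sqr_ge0.
move=> /allP v0; apply/rowP => i; rewrite mxE.
by apply/eqP; rewrite -sqrf_eq0 expr2; apply: v0; rewrite mem_index_enum.
Qed.

Lemma dim_fullv : \dim {:'rV[R]_d} = d.
Proof. by rewrite dimvf /dim /= mul1n. Qed.

Definition hyperplane h : {vspace 'rV[R]_d} := lker (linfun (mulmxr h^T)).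

Lemma memv_hyperplane h v : (v \in hyperplane h) = (dot v h == 0).
Proof.
rewrite memv_ker lfunE /= dotE; apply/eqP/eqP => [->|e]; first by rewrite mxE.
by apply/matrixP => i j; rewrite !ord1 e mxE.
Qed.

Lemma dim_cap_hyperplane U h : (\dim U <= \dim (U :&: hyperplane h) + 1)%N.
Proof.
rewrite -(limg_ker_dim (linfun (mulmxr h^T)) U) leq_add2l.
by apply: leq_trans (dimvS (subvf _)) _; rewrite dimvf.
Qed.

Definition cutv U cs : {vspace 'rV[R]_d} := foldr (fun h W => W :&: hyperplane h)%VS U cs.

Lemma mem_cutv U cs v : (v \in cutv U cs) = (v \in U) && all (fun h => dot v h == 0) cs.
Proof.
elim: cs => [|h cs IH] /=; first by rewrite andbT.
by rewrite memv_cap IH memv_hyperplane -andbA [X in _ && X]andbC.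
Qed.

Lemma dim_cutv_ge U cs : (\dim U <= \dim (cutv U cs) + size cs)%N.
Proof.
elim: cs => [|h cs IH] /=; first by rewrite addn0.
by have := dim_cap_hyperplane (cutv U cs) h; lia.
Qed.

(** Each hyperplane lowers the dimension by at most one, and the subspace
    orthogonal to cs meets the span of cs in 0 because the dot product is
    definite. *)
Lemma dim_cutv_free cs : free cs -> (\dim (cutv fullv cs) = d - size cs)%N.
Proof.
move=> cs_free.
have cap0 : (<<cs>> :&: cutv fullv cs = 0)%VS.
  apply/eqP; rewrite -subv0; apply/subvP => v; rewrite memv_cap mem_cutv => /and3P[vcs _ /allP v0].
  rewrite memv0; apply/eqP/dot_self_eq0/eqP; rewrite -memv_hyperplane.
  move: vcs; apply/subvP/span_subvP => h hcs.
  by rewrite memv_hyperplane dotC; exact: v0.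
have sumD := dimv_disjoint_sum cap0; rewrite (eqP cs_free) in sumD.
have sum_le := dimvS (subvf (<<cs>> + cutv fullv cs)%VS); rewrite dim_fullv in sum_le.
have cut_ge := dim_cutv_ge fullv cs; rewrite dim_fullv in cut_ge.
have arith a b c e : a = (b + c)%N -> (a <= e)%N -> (e <= c + b)%N -> c = (e - b)%N by lia.
exact: arith sumD sum_le cut_ge.
Qed.

End Dot.

Section GeneralPosition.
Variables (R : realType) (d : nat).
Notation V := 'rV[R]_d.
Implicit Types (u v h y z q : V) (U W : {vspace V}) (s T L : seq V) (m : seq bool).

(** The values to which a vector may attach. For independent vectors these are
    the 2 |T| + 1 elements of {0} u T u -T. *)
Fixpoint signed T : seq V :=
  if T is z :: T' then z :: - z :: signed T' else [:: 0].

(** The default 0 of [head] makes the last entry the last vector itself. *)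
Fixpoint chain L : seq V :=
  if L is z :: L' then (z - head 0 L') :: chain L' else [::].

Lemma size_chain L : size (chain L) = size L.
Proof. by elim: L => //= z L ->. Qed.

Lemma nth_chain L i : (i < size L)%N -> nth 0 (chain L) i = nth 0 L i - nth 0 L i.+1.
Proof. by elim: L i => // z L IH [|i] /= iL; rewrite ?IH // nth0. Qed.

Definition signed_vectors (ps : seq (bool * V)) : seq V :=
  [seq (-1) ^+ (p.1 : bool) *: p.2 | p : bool * V <- ps].

(** Stated through dimensions (with truncated subtraction) rather than through
    freeness, the condition is meaningful on a subspace U and for more
    conditions than dim U. *)
Definition gen_pos s U : Prop := forall ps m,
  perm_eq (map snd ps) s -> size m = size s ->
  (\dim (cutv U (mask m (chain (signed_vectors ps)))) = \dim U - count id m)%N.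

Lemma gen_pos_perm s s' U : perm_eq s s' -> gen_pos s U -> gen_pos s' U.
Proof.
move=> ss' gp ps m pss ms; apply: gp; last by rewrite ms (perm_size ss').
by rewrite (perm_trans pss) // perm_sym.
Qed.

Lemma mem_signed T q :
  reflect (q = 0 \/ exists2 z, z \in T & exists b : bool, q = (-1) ^+ b *: z) (q \in signed T).
Proof.
apply: (iffP idP).
  elim: T => [|z T IH] /=; first by rewrite inE => /eqP->; left.
  rewrite !inE => /or3P[/eqP->|/eqP->|/IH[->|[z' zT [b ->]]]]; last 2 first.
  - by left.
  - by right; exists z'; rewrite ?inE ?zT ?orbT //; exists b.
  - by right; exists z; rewrite ?inE ?eqxx //; exists false; rewrite scale1r.
  - by right; exists z; rewrite ?inE ?eqxx //; exists true; rewrite scaleN1r.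
case=> [->|[z zT [b ->]]].
  by elim: T => [|z T IH] /=; rewrite ?inE ?eqxx // IH !orbT.
elim: T zT => //= x T IH; rewrite !inE => /orP[/eqP->|/IH->]; last by rewrite !orbT.
by case: b {IH}; rewrite ?scaleN1r ?scale1r eqxx ?orbT.
Qed.

(** On the hyperplane y = head L2, inserting y before L2 changes neither the
    conditions carried by L2 nor the one linking L1 to L2. *)
Lemma chain_insert v y L1 L2 m1 m2 : size m1 = size L1 ->
  all (fun h => dot v h == 0) (mask (m1 ++ true :: m2) (chain (L1 ++ y :: L2))) =
  (dot v (y - head 0 L2) == 0) &&
  all (fun h => dot v h == 0) (mask (m1 ++ m2) (chain (L1 ++ L2))).
Proof.
elim: L1 m1 => [|z L1 IH] [|b m1] //= [sm].
have all_if (B : bool) h t : all (fun h => dot v h == 0) (if B then h :: t else t) =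
   (B ==> (dot v h == 0)) && all (fun h => dot v h == 0) t by case: B.
rewrite !all_if.
rewrite IH //; case: L1 {IH sm} => [|x L1] /=; last by rewrite andbCA.
rewrite andbCA; case: eqP => //= e; congr ((_ ==> _) && _).
by congr (_ == 0); move: e; rewrite !dotBr => /eqP; rewrite subr_eq0 => /eqP->.
Qed.

(** If y = q on a hyperplane, and q is 0 or a signed element of s, then a signed
    copy of y fits just before q (or last, when q = 0), joined to it by a marked
    link. *)
Lemma gen_pos_insert y s U q ps m : gen_pos (y :: s) U -> q \in signed s ->
  perm_eq (map snd ps) s -> size m = size s ->
  (\dim (cutv (U :&: hyperplane (y - q)) (mask m (chain (signed_vectors ps)))) =
   \dim U - (count id m).+1)%N.
Proof.
move=> gp qs pss ms.
have [ps1 [ps2 [b [eps eq]]]] : exists ps1 ps2 (b : bool), ps = ps1 ++ ps2 /\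
    (-1) ^+ b *: q = head 0 (signed_vectors ps2).
  case/mem_signed: qs => [->|[z zs [c ->]]].
    by exists ps, [::], false; rewrite cats0 scaler0.
  move: zs; rewrite -(perm_mem pss) => /mapP[p pps ->].
  case/splitPr: pps => ps1 ps2; exists ps1, (p :: ps2), (c (+) p.1); split=> //=.
  by rewrite scalerA -signr_addb addbAC addbb.
have sps : size ps = size s by rewrite -(size_map snd) (perm_size pss).
pose k := size ps1.
have smk : size (take k m) = k by rewrite size_takel // ms -sps eps size_cat leq_addr.
have := gp (ps1 ++ (b, y) :: ps2) (take k m ++ true :: drop k m).
rewrite count_cat /= addnCA -count_cat cat_take_drop add1n => <-.
- congr (\dim _); apply/vspaceP => v; rewrite !mem_cutv memv_cap memv_hyperplane -andbA.
  congr (_ && _); rewrite /signed_vectors map_cat /= chain_insert ?size_map //.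
  rewrite -/(signed_vectors ps2) -eq -scalerBr dotZr mulf_eq0 signr_eq0 /=.
  by rewrite cat_take_drop -map_cat -eps.
- rewrite map_cat /= -(cat1s y) perm_catCA /= perm_cons -map_cat -eps.
  exact: pss.
- by rewrite size_cat /= addnS -size_cat cat_take_drop ms.
Qed.

Lemma gen_pos_dim y s U q : gen_pos (y :: s) U -> q \in signed s ->
  (\dim (U :&: hyperplane (y - q)) = \dim U - 1)%N.
Proof.
move=> gp qs; have := @gen_pos_insert y s U q [seq (false, z) | z <- s] (nseq (size s) false).
rewrite mask_false count_nseq mul0n -map_comp map_id size_nseq; exact.
Qed.

(** Restriction to the hyperplane y = q makes y redundant, costs one dimension,
    and leaves the remaining vectors in general position. *)
Lemma gen_pos_cut y s U q : gen_pos (y :: s) U -> q \in signed s ->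
  gen_pos s (U :&: hyperplane (y - q)).
Proof.
move=> gp qs ps m pss ms; rewrite (gen_pos_insert gp qs pss ms) (gen_pos_dim gp qs); lia.
Qed.

(** Put y in front and leave its link unmarked. *)
Lemma gen_pos_drop y s U : gen_pos (y :: s) U -> gen_pos s U.
Proof.
move=> gp ps m pss ms; have := gp ((false, y) :: ps) (false :: m).
by rewrite /= perm_cons add0n ms => /(_ pss erefl).
Qed.

End GeneralPosition.

(** One statement for the two ways of reaching exactly k elements from A: adding
    some, or removing some. *)
Lemma set_between (T : finType) (A : {set T}) k : (k <= #|T|)%N ->
  exists2 B : {set T}, #|B| = k & if (#|A| <= k)%N then A \subset B else B \subset A.
Proof.
move=> kT; pose s := enum A ++ enum (~: A)%SET.
have us : uniq s.
  rewrite cat_uniq !enum_uniq andbT; apply/hasPn => x; by rewrite !mem_enum inE.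
have ss : size s = #|T| by rewrite size_cat -!cardE cardsC.
exists [set x in take k s]%SET.
  by rewrite cardsE (card_uniqP (take_uniq _ us)) size_takel ?ss.
case: ifP => Ak; apply/fintype.subsetP => x; rewrite inE => xA.
  by rewrite take_cat -cardE ltnNge Ak /= mem_cat mem_enum xA.
have kA : (k < #|A|)%N by rewrite ltnNge Ak.
by move: xA; rewrite take_cat -cardE kA => /mem_take; rewrite mem_enum.
Qed.

(** A marked subset I of at most d links extends to one of exactly d links, which
    is free by hypothesis; a larger one contains d links, which already cut the
    space down to 0. *)
Lemma gen_pos_full (R : realType) (d n : nat) (y : 'I_n -> 'rV[R]_d) :
  typeB_general_position y -> gen_pos [seq y i | i <- enum 'I_n] fullv.
Proof.
move=> [dn gp] ps m; rewrite (size_map y) size_enum_ord => pss ms.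
have sps : size ps = n by rewrite -(size_map snd) (perm_size pss) (size_map y) size_enum_ord.
have [s es] : exists s : 'S_n, map snd ps = [seq y (s i) | i <- enum 'I_n].
  have e : [seq y i | i <- enum 'I_n] = [tuple y i | i < n] by [].
  move: pss; rewrite e => /tuple_permP[s ->]; exists s.
  by rewrite /=; apply: eq_map => i; rewrite tnth_mktuple.
pose eps (i : 'I_n) := (nth (false, 0) ps i).1.
pose f := typeB_vector y eps s.
(* The signs and the order of ps are those of a signed permutation. *)
have nth_ps (i : 'I_n) : nth 0 (signed_vectors ps) i = (-1) ^+ eps i *: y (s i).
  rewrite (nth_map (false, 0)) ?sps //; congr (_ *: _).
  by rewrite -(nth_map _ 0 snd) ?sps // es (nth_map i) ?size_enum_ord // nth_ord_enum.
have ech : chain (signed_vectors ps) = [seq f i | i <- enum 'I_n].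
  apply: (@eq_from_nth _ 0) => [|i]; rewrite size_chain (size_map _ ps) sps.
    by rewrite size_map size_enum_ord.
  move=> lt_in; rewrite (nth_map (Ordinal lt_in)) ?size_enum_ord //.
  rewrite (_ : nth _ (enum _) i = Ordinal lt_in); last exact: (nth_ord_enum _ (Ordinal lt_in)).
  rewrite nth_chain ?size_map ?sps // (nth_ps (Ordinal lt_in)) /f /typeB_vector.
  case: insubP => /= [j _ ej|]; first by rewrite -ej nth_ps.
  by rewrite -leqNgt => ni; rewrite nth_default ?subr0 // size_map sps.
pose I := [set i : 'I_n | nth false m i]%SET.
have eI : mask m (enum 'I_n) = enum I.
  rewrite [in RHS]/enum_mem -enumT filter_mask; congr mask.
  apply: (@eq_from_nth _ false) => [|i]; rewrite ms; first by rewrite size_map size_enum_ord.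
  move=> lt_in; rewrite (nth_map (Ordinal lt_in)) ?size_enum_ord //.
  rewrite (nth_ord_enum _ (Ordinal lt_in)) -[RHS]/(Ordinal lt_in \in I).
  by rewrite inE.
have cI : count id m = #|I| by rewrite cardE -eI size_mask // ms size_enum_ord.
rewrite ech -map_mask eI cI dim_fullv.
have [J cJ] := @set_between _ I d (eq_ind_r (leq d) dn (card_ord n)).
have freeJ := gp eps s J cJ.
case: ifP => [Id IJ|/negbT Id JI].
  rewrite dim_cutv_free; first by rewrite (size_map f) -cardE.
  have pJ : perm_eq [seq f i | i <- enum J]
      ([seq f i | i <- enum I] ++ [seq f i | i <- [seq i <- enum J | predC (mem I) i]]).
    rewrite -map_cat perm_map // -(permPl (permEl (perm_filterC (mem I) (enum J)))).
    rewrite perm_cat2r.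
    apply: uniq_perm; [exact/filter_uniq/enum_uniq | exact: enum_uniq | move=> i].
    rewrite mem_filter !mem_enum; apply: andb_idr; exact: (fintype.subsetP IJ).
  by move: freeJ; rewrite (perm_free pJ) => /catl_free.
rewrite (_ : (d - #|I|)%N = 0%N); last by apply/eqP; rewrite subn_eq0 ltnW // ltnNge.
have dJ : (\dim (cutv fullv [seq f i | i <- enum J]) = 0)%N.
  by rewrite dim_cutv_free // (size_map f) -cardE cJ subnn.
apply/eqP; rewrite -leqn0;
apply: leq_trans (_ : _ <= \dim (cutv fullv [seq f i | i <- enum J]))%N _; last by rewrite dJ.
apply/dimvS/subvP => v.
rewrite !mem_cutv => /andP[-> /= /allP vI]; apply/allP => _ /mapP[i iJ ->].
by apply/vI/map_f; move: iJ; rewrite !mem_enum; apply/fintype.subsetP.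
Qed.

(** * Counting the chambers of a type B arrangement *)

Lemma card_disjU (T : choiceType) (A B : set T) (p q : nat) :
  (A #= `I_p)%card -> (B #= `I_q)%card -> A `&` B = set0 ->
  (A `|` B #= `I_(p + q))%card.
Proof.
move=> cA cB AB0.
have fA : finite_set A by apply/finite_setP; exists p.
have fB : finite_set B by apply/finite_setP; exists q.
rewrite -(fset_setK (_ : finite_set (A `|` B))) ?finite_setU //.
apply/card_eq_fsetP; rewrite fset_setU // finmap.cardfsU -fset_setI // AB0 fset_set0.
by rewrite finmap.cardfs0 subn0 (card_fset_set cA) (card_fset_set cB).
Qed.

Lemma card_inj_image (T U : Type) (f : T -> U) (A : set T) n :
  {in A &, injective f} -> (A #= `I_n)%card -> (f @` A #= `I_n)%card.
Proof. by move=> inj_f cA; apply: card_eq_trans cA; exact: inj_card_eq. Qed.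

(** Two invariants that separate the points of A in the same way take equally
    many values on A. *)
Lemma card_same_fibers (X : choiceType) (T U : Type) (x0 : X) (f : X -> T) (g : X -> U)
    (A : set X) n :
  (forall x x', A x -> A x' -> f x = f x' <-> g x = g x') ->
  (f @` A #= `I_n)%card -> (g @` A #= `I_n)%card.
Proof.
move=> fg; pose r t := xget x0 [set x | A x /\ f x = t].
have rP x : A x -> A (r (f x)) /\ f (r (f x)) = f x.
  by move=> Ax; apply: (xgetPex x0 (P := [set z | A z /\ f z = f x])); exists x.
have -> : g @` A = (g \o r) @` (f @` A).
  rewrite image_comp; apply/seteqP; split=> _ [x Ax <-]; exists x => //=;
    have [Ar fr] := rP x Ax; exact/fg.
apply: card_inj_image => _ _ /set_mem[x Ax <-] /set_mem[x' Ax' <-] /=.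
have [Ar fr] := rP x Ax; have [Ar' fr'] := rP x' Ax'.
by move=> /fg - /(_ Ar Ar'); rewrite fr fr'.
Qed.

Section Regions.
Variables (R : realType) (d : nat).
Notation V := 'rV[R]_d.
Implicit Types (u v h x y z q : V) (U W : {vspace V}) (a s T : seq V).

(** Strict sign conditions are open along a line; the bound e is explicit, so no
    topology is used. *)
Lemma perturb a x u : exists2 e : R, 0 < e &
  forall t, `|t| <= e -> forall h, h \in a ->
    (0 < dot x h -> 0 < dot (x + t *: u) h) /\ (dot x h < 0 -> dot (x + t *: u) h < 0).
Proof.
elim: a => [|h a [e e0 IH]]; first by exists 1.
pose e1 := if dot x h == 0 then 1 else `|dot x h| / (`|dot u h| + 1).
have u1 : 0 < `|dot u h| + 1 by rewrite ltr_wpDl.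
have e10 : 0 < e1 by rewrite /e1; case: eqVneq => // xh; rewrite divr_gt0 ?normr_gt0.
exists (Num.min e e1) => [|t]; first by rewrite lt_min e0.
rewrite le_min => /andP[te te1] g; rewrite inE => /orP[/eqP->|]; last exact: IH.
move: te1; rewrite /e1 dotDl dotZl; case: eqVneq => [->|xh te1]; first by rewrite ltxx.
have : `|t * dot u h| < `|dot x h|.
  rewrite normrM; apply: le_lt_trans (_ : _ <= `|dot x h| / (`|dot u h| + 1) * `|dot u h|) _.
    by rewrite ler_wpM2r.
  rewrite -mulrA gtr_pMr ?normr_gt0 // mulrC ltr_pdivrMr // mul1r ltrDl //.
rewrite ltr_norml => /andP[lo hi]; split=> xs;
  [rewrite gtr0_norm // in lo|rewrite ltr0_norm // in hi]; lra.
Qed.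

Definition positivity a x : seq bool := [seq 0 < dot x h | h <- a].
Definition regular a x : bool := all (fun h => dot x h != 0) a.
Definition regions a U : set (seq bool) :=
  positivity a @` [set x | x \in U /\ regular a x].

Lemma positivity_eq a x x' h : positivity a x = positivity a x' -> h \in a ->
  (0 < dot x h) = (0 < dot x' h).
Proof. by move/eq_in_map => e /e. Qed.

Lemma perturb_regular a x u : regular a x -> exists2 e : R, 0 < e &
  forall t, `|t| <= e -> regular a (x + t *: u) /\ positivity a (x + t *: u) = positivity a x.
Proof.
move=> /allP reg; have [e e0 P] := perturb a x u; exists e => // t te; split.
  apply/allP => h ha; have [P1 P2] := P t te h ha.
  by have := reg h ha; rewrite neq_lt => /orP[/P2|/P1] ? ; rewrite neq_lt; apply/orP; [left|right].
apply/eq_in_map => h ha; have [P1 P2] := P t te h ha.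
have := reg h ha; rewrite neq_lt => /orP[|] xh; last by rewrite xh P1.
by rewrite !ltNge !ltW // P2.
Qed.

(** Deletion and restriction: a region of a splits under h into its two sides
    exactly when it meets the hyperplane of h. Regions meeting both sides meet
    the hyperplane by convexity, and those meeting the hyperplane meet both
    sides by perturbation along u. *)
Lemma regions_cons h a U (N0 N1 : nat) : (exists2 u, u \in U & dot u h != 0) ->
  (regions a U #= `I_N0)%card -> (regions a (U :&: hyperplane h) #= `I_N1)%card ->
  (regions (h :: a) U #= `I_(N0 + N1))%card.
Proof.
move=> [u uU uh] cp cq.
pose A t := regions (h :: a) U (true :: t); pose B t := regions (h :: a) U (false :: t).
have inU x t : x \in U -> x + t *: u \in U by move=> xU; rewrite memvD ?memvZ.
have sub b t : regions (h :: a) U (b :: t) -> regions a U t.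
  by move=> [x [xU /= /andP[_ reg]] [_ <-]]; exists x.
have side x b : x \in U -> regular a x -> dot x h = 0 ->
    regions (h :: a) U (b :: positivity a x).
  move=> xU reg xh; have [e e0 P] := perturb_regular u reg.
  have [c [ce cb c0]] : exists c, [/\ `|c| <= e, (0 < c * dot u h) = b & c != 0].
    have en : `|e| <= e by rewrite gtr0_norm.
    have en' : `|- e| <= e by rewrite normrN.
    have [u0|u0] : dot u h < 0 \/ 0 < dot u h by apply/orP; rewrite -neq_lt.
      have eu : e * dot u h < 0 by rewrite pmulr_rlt0.
      case: b; first by exists (- e); rewrite mulNr oppr_gt0 eu oppr_eq0 gt_eqF.
      by exists e; rewrite (lt_gtF eu) gt_eqF.
    have eu : 0 < e * dot u h by rewrite mulr_gt0.
    case: b; first by exists e; rewrite eu gt_eqF.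
    by exists (- e); rewrite mulNr oppr_gt0 (lt_gtF eu) oppr_eq0 gt_eqF.
  have [Pr Pp] := P c ce; exists (x + c *: u).
    by split; rewrite ?inU //= Pr andbT dotDl xh add0r dotZl mulf_neq0.
  by rewrite /positivity /= -[map _ a]/(positivity a _) Pp dotDl xh add0r dotZl cb.
have AorB t : regions a U t -> A t \/ B t.
  move=> [x [xU reg] <-]; case: (eqVneq (dot x h) 0) => xh; first by left; apply: side.
  case: (boolP (0 < dot x h)) => x0; [left|right]; exists x => //; try by split=> //=; rewrite xh.
    by rewrite /positivity /= x0.
  by rewrite /positivity /= (negbTE x0).
have AandB t : regions a (U :&: hyperplane h) t <-> A t /\ B t.
  split.
    move=> [x [xU reg] <-]; move: xU; rewrite memv_cap memv_hyperplane => /andP[xU /eqP xh].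
    by split; apply: side.
  case=> [[x [xU /= /andP[xh reg]] [xp xt]] [x' [xU' /= /andP[xh' reg']] [xp' xt']]].
  have {}xp' : dot x' h < 0 by rewrite lt_neqAle xh' leNgt xp'.
  (* The point of the segment from x to x' (up to a positive factor) on h. *)
  pose w := (- dot x' h) *: x + dot x h *: x'.
  have wp g : (0 < dot x g -> 0 < dot x' g -> 0 < dot w g) /\
              (dot x g < 0 -> dot x' g < 0 -> dot w g < 0).
    by rewrite dotDl !dotZl; split; nra.
  have wg g : g \in a -> dot w g != 0 /\ (0 < dot w g) = (0 < dot x g).
    move=> ga; have [w1 w2] := wp g; have := positivity_eq (etrans xt (esym xt')) ga.
    have := allP reg g ga; have := allP reg' g ga; rewrite /= !neq_lt.
    move=> /orP[|] g1 /orP[|] g2; rewrite ?g1 ?g2 ?(lt_gtF g1) ?(lt_gtF g2) // => _.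
      by have := w2 g2 g1 => wl; rewrite wl (lt_gtF wl).
    by rewrite (w1 g2 g1) orbT.
  exists w; last by rewrite -xt; apply/eq_in_map => g /wg[].
  split; last by apply/allP => g /wg[].
  rewrite memv_cap memvD ?memvZ //= memv_hyperplane dotDl !dotZl; apply/eqP; ring.
have -> : regions (h :: a) U = (fun t => `[< A t >] :: t) @` regions a U `|`
                               cons false @` regions a (U :&: hyperplane h).
  apply/seteqP; split=> [t|t].
    case: t => [|b t] Rt; first by case: Rt => x _ [].
    have Ut := sub _ _ Rt; case: (pselect (A t)) => At.
      case: b Rt => Rt; first by left; exists t => //; rewrite asboolT.
      by right; exists t => //; apply/AandB.
    left; exists t => //; rewrite asboolF //; by case: b Rt.
  case=> [[{}t Ut <-]|[{}t /AandB[_ Bt] <-]] //.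
  case: (pselect (A t)) => At; first by rewrite asboolT.
  by rewrite asboolF //; case: (AorB t Ut).
apply: card_disjU.
- by apply: card_inj_image cp => t t' _ _ [].
- by apply: card_inj_image cq => t t' _ _ [].
apply/seteqP; split=> // _ [[t Ut <-] [t' /AandB[At _] [e1 e2]]].
by move: At; rewrite e2 => /asboolT; rewrite -e1.
Qed.

(** The normals of the type B arrangement of T. For T = [:: z] this is z - 0. *)
Fixpoint arr T : seq V :=
  if T is z :: T' then [seq z - q | q <- signed T'] ++ arr T' else [::].

Lemma size_signed T : size (signed T) = (2 * size T).+1.
Proof. by elim: T => //= z T ->; lia. Qed.

Lemma signed0 T : 0 \in signed T.
Proof. by apply/mem_signed; left. Qed.

Lemma signedN T q : q \in signed T -> - q \in signed T.
Proof.
case/mem_signed => [->|[z zT [b ->]]]; apply/mem_signed; first by rewrite oppr0; left.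
by right; exists z => //; exists (~~ b); rewrite signrN scaleNr.
Qed.

Lemma mem_arr T h : h \in arr T -> exists p q, [/\ p \in signed T, q \in signed T & h = p - q].
Proof.
elim: T => //= z T IH; rewrite mem_cat => /orP[/mapP[q qT ->]|/IH[p [q [pT qT ->]]]].
  by exists z, q; rewrite !inE eqxx qT !orbT.
by exists p, q; rewrite !inE pT qT !orbT.
Qed.

(** The only differences of signed values that are not normals up to sign are
    z - (- z) = 2 z and its opposite, whence the scalar c. *)
Lemma signed_sub_arr T p q : p \in signed T -> q \in signed T -> p != q ->
  exists2 c : R, c != 0 & exists2 h, h \in arr T & p - q = c *: h.
Proof.
have [zle z2] : (-1 != 0 :> R) /\ (-2 != 0 :> R) by split; rewrite oppr_eq0 ?oner_eq0 ?pnatr_eq0.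
elim: T p q => [|z T IH] p q /=; first by rewrite !inE => /eqP-> /eqP->; rewrite eqxx.
have A r : r \in signed T -> z - r \in [seq z - q | q <- signed T] ++ arr T.
  by move=> rT; rewrite mem_cat (map_f (fun q => z - q) rT).
have A0 := A 0 (signed0 T); rewrite subr0 in A0.
have IH' : p \in signed T -> q \in signed T -> p != q ->
    exists2 c : R, c != 0 & exists2 h, h \in [seq z - q | q <- signed T] ++ arr T & p - q = c *: h.
  move=> pT qT pq; have [c c0 [h hT e]] := IH p q pT qT pq.
  by exists c => //; exists h => //; rewrite mem_cat hT orbT.
rewrite !inE => /or3P[/eqP->|/eqP->|pT] /or3P[/eqP->|/eqP->|qT] pq; rewrite ?eqxx // in pq *.
- by exists 2; rewrite ?pnatr_eq0 //; exists z => //; rewrite opprK scaler_nat.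
- by exists 1; rewrite ?oner_eq0 //; exists (z - q); rewrite ?A ?scale1r.
- by exists (- 2) => //; exists z => //; rewrite scaleNr scaler_nat mulr2n opprD.
- by exists (-1) => //; exists (z - - q); [apply/A/signedN|rewrite scaleN1r opprB addrC].
- by exists (-1) => //; exists (z - p); rewrite ?A ?scaleN1r ?opprB.
- by exists 1; rewrite ?oner_eq0 //; exists (z - - p); [apply/A/signedN|rewrite scale1r !opprK addrC].
- exact: IH'.
Qed.

Lemma regular_signed T x p q : regular (arr T) x -> p \in signed T -> q \in signed T ->
  p != q -> dot x (p - q) != 0.
Proof.
move=> reg pT qT pq; have [c c0 [h hT ->]] := signed_sub_arr pT qT pq.
by rewrite dotZr mulf_neq0 //; exact: (allP reg).
Qed.

(** A chamber of the arrangement of T is a strict total order of the signed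
    values of T. *)
Lemma positivity_signed T x x' p q : regular (arr T) x -> regular (arr T) x' ->
  positivity (arr T) x = positivity (arr T) x' ->
  p \in signed T -> q \in signed T -> (0 < dot x (p - q)) = (0 < dot x' (p - q)).
Proof.
move=> reg reg' e pT qT; case: (eqVneq p q) => [->|pq]; first by rewrite subrr !dot0r.
have [c c0 [h hT ->]] := signed_sub_arr pT qT pq.
have := allP reg h hT; have := allP reg' h hT; rewrite !dotZr /= => h0 h0'.
have eh := positivity_eq e hT.
have [c1|c1] : c < 0 \/ 0 < c by apply/orP; rewrite -neq_lt.
  by rewrite !nmulr_rgt0 // !lt_neqAle h0 h0' /= !leNgt eh.
by rewrite !pmulr_rgt0.
Qed.

(** Repetitions in T produce the normal 0, which no point avoids. *)
Lemma regular_uniq T x : regular (arr T) x -> uniq (signed T).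
Proof.
elim: T => //= z T IH; rewrite /regular all_cat => /andP[/allP zr /IH ->]; rewrite andbT inE negb_or.
have zN q : q \in signed T -> z != q.
  by move=> qT; have := zr _ (map_f (fun q => z - q) qT); apply: contraNneq => ->; rewrite subrr dot0r.
rewrite -andbA; apply/and3P; split.
- have := zr _ (map_f (fun q => z - q) (signed0 T)); rewrite subr0; apply: contraNneq => e.
  have : dot x z *+ 2 = 0 by rewrite mulr2n {2}e dotNr subrr.
  by move/eqP; rewrite mulrn_eq0.
- by apply/negP => /zN/eqP.
- by apply/negP => /signedN; rewrite opprK => /zN/eqP.
Qed.

Lemma vspace_proper_hyperplane U h : (\dim (U :&: hyperplane h) < \dim U)%N ->
  exists2 u, u \in U & dot u h != 0.
Proof.
move=> lt_dim; have /subvPn[u uU uh] : ~~ (U <= hyperplane h)%VS.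
  by apply: contraL lt_dim => /capv_idPl->; rewrite ltnn.
by exists u => //; rewrite -memv_hyperplane.
Qed.

(** Add the hyperplanes y = q one at a time. On the section y = q, the hyperplane
    y = q' coincides with q = q', which already belongs to the arrangement
    of T, so that restriction returns the regions of T. *)
Lemma card_regions_cons y T U qs N0 N1 : gen_pos (y :: T) U -> (0 < \dim U)%N ->
  subseq qs (signed T) -> (regions (arr T) U #= `I_N0)%card ->
  (forall q, q \in signed T -> regions (arr T) (U :&: hyperplane (y - q)) #= `I_N1)%card ->
  (regions ([seq (y - q)%R | q <- qs] ++ arr T) U #= `I_(N0 + size qs * N1))%card.
Proof.
move=> gp U0 sub cU cq; elim: qs sub => [|q qs IH] sub; first by rewrite mul0n addn0.
have qT : q \in signed T by apply: (mem_subseq sub); rewrite mem_head.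
rewrite /= mulSn addnCA addnC.
apply: regions_cons.
- apply: vspace_proper_hyperplane; rewrite (gen_pos_dim gp qT); lia.
- by apply: IH; apply: subseq_trans sub; exact: subseq_cons.
have qq' q' x : q' \in qs -> regular (arr T) x -> q != q'.
  move=> q's reg; have := subseq_uniq sub (regular_uniq reg).
  by rewrite /= => /andP[+ _]; apply: contraNneq => ->.
have qsT q' : q' \in qs -> q' \in signed T.
  by move=> q's; apply: (mem_subseq sub); rewrite inE q's orbT.
have onH x q' : x \in (U :&: hyperplane (y - q))%VS -> dot x (y - q') = dot x (q - q').
  by rewrite memv_cap memv_hyperplane => /andP[_]; rewrite !dotBr subr_eq0 => /eqP->.
rewrite /regions.
rewrite (_ : [set x | _] = [set x | x \in (U :&: hyperplane (y - q))%VS /\ regular (arr T) x]); last first.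
  apply/seteqP; split=> x [xU reg]; split=> //.
    by move: reg; rewrite /regular all_cat => /andP[].
  rewrite /regular all_cat; apply/andP; split=> //; apply/allP => _ /mapP[q' q's ->].
  by rewrite onH //; apply: (regular_signed reg) => //; [exact: qsT|exact: (qq' _ x)].
apply: (card_same_fibers (0 : V) _ (cq q qT)) => x x' [xU reg] [xU' reg'].
rewrite /positivity !map_cat -!/(positivity _ _); split=> [e|/eqP]; last first.
  by rewrite eqseq_cat ?size_map // => /andP[_ /eqP].
rewrite e; congr (_ ++ _); rewrite /positivity -!map_comp; apply/eq_in_map => q' q's /=.
by rewrite !onH //; apply: (positivity_signed reg reg' e) => //; exact: qsT.
Qed.

Lemma card_regions_nil U : (regions [::] U #= `I_1)%card.
Proof.
rewrite (_ : regions _ _ = [set [::]]); first exact: card_set1.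
apply/seteqP; split=> [_ [x _ <-] //|_ ->].
by exists 0 => //; split=> //; exact: mem0v.
Qed.

Lemma regions_dim0 y T U : \dim U = 0%N -> regions (arr (y :: T)) U = set0.
Proof.
move=> /eqP; rewrite dimv_eq0 => /eqP U0; rewrite -subset0 => t [x [xU /allP reg] _].
move: xU; rewrite U0 memv0 => /eqP x0.
have := reg (y - 0); rewrite /= mem_cat (map_f (fun q => y - q) (signed0 T)) => /(_ isT).
by rewrite x0 dot0l eqxx.
Qed.

(** Induction on the list; the section by y = q has one dimension less and T is
    still in general position on it. *)
Lemma card_regions_arr y T U : gen_pos (y :: T) U ->
  (regions (arr (y :: T)) U #= `I_(DB (size T).+1 (\dim U)))%card.
Proof.
elim: T y U => [|y' T IH] y U gp; case eU : (\dim U) => [|k].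
- by rewrite DB_S0 regions_dim0 // II0.
- have := @card_regions_cons y [::] U (signed [::]) 1 1 gp.
  rewrite eU DB_1S; apply=> // *; exact: card_regions_nil.
- by rewrite DB_S0 regions_dim0 // II0.
have cU : (regions (arr (y' :: T)) U #= `I_(DB (size T).+1 k.+1))%card.
  by rewrite -eU; exact/IH/(gen_pos_drop gp).
rewrite [size _]/= DB_rec.
have -> : (2 * (size T).+1 + 1)%N = size (signed (y' :: T)) by rewrite size_signed addn1.
have U0 : (0 < \dim U)%N by rewrite eU.
refine (card_regions_cons gp U0 (subseq_refl _) cU _) => q qT.
have -> : k = \dim (U :&: hyperplane (y - q)) by rewrite (gen_pos_dim gp qT) eU subn1.
by apply: IH; exact: gen_pos_cut gp qT.
Qed.
End Regions.

(** * Counting sign cones, stratified by dimension *)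

Section Faces.
Variables (R : realType) (d : nat).
Notation V := 'rV[R]_d.
Implicit Types (u v h x y z p q : V) (U W : {vspace V}) (a s T Y : seq V).

(** The closed cone of the points whose signs are obtained from those of x by
    replacing some of them by 0. *)
Definition cone a x : set V :=
  [set v | forall h, h \in a ->
     (0 <= dot x h -> 0 <= dot v h) /\ (dot x h <= 0 -> dot v h <= 0)].

Definition flat a x : {vspace V} := cutv fullv [seq h <- a | dot x h == 0].

Lemma mem_flat a x v :
  reflect (forall h, h \in a -> dot x h = 0 -> dot v h = 0) (v \in flat a x).
Proof.
rewrite mem_cutv memvf /=; apply: (iffP allP) => H h.
  by move=> ha /eqP xh; apply/eqP/H; rewrite mem_filter xh.
by rewrite mem_filter => /andP[/eqP xh ha]; rewrite H.
Qed.

Lemma cone_eqP a x x' :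
  cone a x = cone a x' <-> forall h, h \in a -> Num.sg (dot x h) = Num.sg (dot x' h).
Proof.
split=> [e h ha|e].
  have x_in z : cone a z z by [].
  have [a1 a2] : (0 <= dot x' h -> 0 <= dot x h) /\ (dot x' h <= 0 -> dot x h <= 0).
    by have := x_in x; rewrite {1}e; exact.
  have [b1 b2] : (0 <= dot x h -> 0 <= dot x' h) /\ (dot x h <= 0 -> dot x' h <= 0).
    by have := x_in x'; rewrite -{1}e; exact.
  have e1 : (0 <= dot x h) = (0 <= dot x' h) by apply/idP/idP.
  have e2 : (dot x h <= 0) = (dot x' h <= 0) by apply/idP/idP.
  by move: e1 e2; case: sgrP; case: sgrP.
have e1 h : h \in a -> (0 <= dot x h) = (0 <= dot x' h).
  by move=> ha; rewrite -sgr_ge0 e // sgr_ge0.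
have e2 h : h \in a -> (dot x h <= 0) = (dot x' h <= 0).
  by move=> ha; rewrite -sgr_le0 e // sgr_le0.
by apply/seteqP; split=> v vx h ha; have := vx h ha; rewrite e1 // e2.
Qed.

Lemma signed_sub_mono T T' : {subset T <= T'} -> {subset signed T <= signed T'}.
Proof.
move=> sub q /mem_signed[->|[z zT qz]]; apply/mem_signed; first by left.
by right; exists z => //; exact: sub.
Qed.

Lemma cone_signed Y x x' p q : cone (arr Y) x = cone (arr Y) x' ->
  p \in signed Y -> q \in signed Y -> Num.sg (dot x (p - q)) = Num.sg (dot x' (p - q)).
Proof.
move=> /cone_eqP e pY qY; case: (eqVneq p q) => [->|pq]; first by rewrite subrr !dot0r.
have [c c0 [h hY ->]] := signed_sub_arr pY qY pq.
by rewrite !dotZr !sgrM e.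
Qed.

Lemma flat_signed Y x v p q : v \in flat (arr Y) x -> p \in signed Y -> q \in signed Y ->
  dot x (p - q) = 0 -> dot v (p - q) = 0.
Proof.
move=> /mem_flat e pY qY; case: (eqVneq p q) => [->|pq]; first by rewrite subrr !dot0r.
have [c c0 [h hY ->]] := signed_sub_arr pY qY pq.
rewrite !dotZr => /eqP; rewrite mulf_eq0 (negbTE c0) /= => /eqP xh.
by rewrite (e h) ?mulr0.
Qed.

Variables (Y : seq V) (k : nat).
Hypotheses (dY : (d <= size Y)%N) (hk : (1 <= k <= d)%N).
Let m := (size Y - d + k)%N.

(** The points of U that keep all representatives in T apart and whose face has
    dimension k. *)
Definition stratum T U : set V :=
  [set x | [/\ x \in U, regular (arr T) x & \dim (flat (arr Y) x) = k]].

(** The state of the scan: T are the representatives found, s the vectors still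
    to be scanned, and U the subspace of the attachments made. The second
    clause says that the scanned vectors are attached on U, the third that U
    contains the flats of its points, and the last that every attachment has
    cost one dimension. *)
Definition controlled T U s : Prop :=
  [/\ {subset T ++ s <= Y},
      forall y, y \in Y -> y \in s \/
        exists2 p, p \in signed T & {in U, forall x, dot x y = dot x p},
      forall x v, x \in U -> v \in flat (arr Y) x -> v \in U,
      (size T + size s <= size Y)%N &
      (\dim U = d - (size Y - (size T + size s)))%N].

Lemma controlled_signed T U (a : V) : controlled T U [::] -> a \in signed Y ->
  exists2 p, p \in signed T & {in U, forall x, dot x a = dot x p}.
Proof.
case=> _ att _ _ _ /mem_signed[->|[y yY [b ->]]]; first by exists 0; rewrite ?signed0.
have [//|[p pT yp]] := att y yY.
exists ((-1) ^+ b *: p); last by move=> x xU; rewrite !dotZr yp.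
by case: b; rewrite ?scaleN1r ?scale1r ?signedN.
Qed.

(** When everything is attached, a normal that vanishes at a point regular for T
    is a difference of two equal signed representatives, hence vanishes on U. *)
Lemma controlled_flat T U x : controlled T U [::] -> x \in U -> regular (arr T) x ->
  flat (arr Y) x = U.
Proof.
move=> ctl xU reg; apply/eqP; rewrite eqEsubv; apply/andP; split; apply/subvP => v vU.
  by case: ctl => _ _ flatU _ _; exact: flatU xU vU.
apply/mem_flat => h /mem_arr[a [b [aY bY ->]]].
have [p pT ap] := controlled_signed ctl aY; have [q qT bq] := controlled_signed ctl bY.
rewrite !dotBr ap // bq // (ap v) // (bq v) // -!dotBr => xpq.
case: (eqVneq p q) => [->|pq]; first by rewrite subrr dot0r.
by have := regular_signed reg pT qT pq; rewrite xpq eqxx.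
Qed.

(** On U the signs of all normals are those of differences of signed
    representatives, so that they are determined by the chamber of T. *)
Lemma controlled_fibers T U x x' : controlled T U [::] ->
  x \in U -> regular (arr T) x -> x' \in U -> regular (arr T) x' ->
  positivity (arr T) x = positivity (arr T) x' <-> cone (arr Y) x = cone (arr Y) x'.
Proof.
move=> ctl xU reg xU' reg'; split=> e.
  apply/cone_eqP => h /mem_arr[a [b [aY bY ->]]].
  have [p pT ap] := controlled_signed ctl aY; have [q qT bq] := controlled_signed ctl bY.
  rewrite !dotBr ap // bq // (ap x') // (bq x') // -!dotBr.
  case: (eqVneq p q) => [->|pq]; first by rewrite subrr !dot0r.
  have x0 := regular_signed reg pT qT pq; have x0' := regular_signed reg' pT qT pq.
  rewrite /Num.sg (negbTE x0) (negbTE x0') !(ltNge _ 0) !le0r (negbTE x0) (negbTE x0') /=.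
  by rewrite (positivity_signed reg reg' e pT qT).
have sTY : {subset signed T <= signed Y}.
  by apply: signed_sub_mono => z zT; case: ctl => sub _ _ _ _; apply: sub; rewrite cats0.
apply/eq_in_map => h /mem_arr[p [q [pT qT ->]]].
by rewrite -sgr_gt0 (cone_signed e) ?sTY // sgr_gt0.
Qed.

(** At the end of the scan the face of every point spans U; the dimension of U is
    k precisely when T has m elements, and then the cones are the regions of T. *)
Lemma card_stratum_leaf T U : gen_pos T U -> controlled T U [::] ->
  (cone (arr Y) @` stratum T U #= `I_(flat_ext m 0 (size T) * DB m k))%card.
Proof.
move=> gp ctl /=; have [_ _ _ sT dU] := ctl; rewrite addn0 in sT dU.
have stratumE x : stratum T U x <-> [/\ x \in U, regular (arr T) x & \dim U = k].
  by split=> -[xU reg]; rewrite ?(controlled_flat ctl xU reg) // => dx; split=> //;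
     rewrite (controlled_flat ctl xU reg).
case: (eqVneq (size T) m) => [Tm|Tm].
  have dUk : \dim U = k by rewrite dU Tm /m; lia.
  rewrite mul1n; case: T Tm {dU sT} gp ctl stratumE => [|y T] Tm gp ctl stratumE.
    by move: Tm; rewrite /m /=; lia.
  rewrite (_ : stratum _ U = [set x | x \in U /\ regular (arr (y :: T)) x]); last first.
    by apply/seteqP; split=> x; [case/stratumE | case=> xU reg; apply/stratumE].
  rewrite -Tm -[in DB _ _]dUk; apply: (card_same_fibers (0 : V) _ (card_regions_arr gp)).
  by move=> x x' [xU reg] [xU' reg']; exact: (controlled_fibers ctl).
rewrite mul0n (_ : stratum T U = set0) ?image_set0 ?II0 //.
rewrite -subset0 => x /stratumE[_ _]; rewrite dU => dk; move: Tm; rewrite /m; lia.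
Qed.

Lemma controlled_rep y T U s : controlled T U (y :: s) -> controlled (y :: T) U s.
Proof.
case=> sub att fl sz dU; split=> //.
- by move=> z zT; apply: sub; move: zT; rewrite !(inE, mem_cat) orbCA.
- move=> z zY; have [|[p pT zp]] := att z zY.
    rewrite inE => /orP[/eqP->|]; last by left.
    by right; exists y => //=; rewrite inE eqxx.
  by right; exists p => //=; rewrite !inE pT !orbT.
- by rewrite /= addSnnS.
- by rewrite /= addSnnS.
Qed.

Lemma controlled_attach y T U s q : gen_pos (T ++ y :: s) U ->
  controlled T U (y :: s) -> q \in signed T ->
  gen_pos (T ++ s) (U :&: hyperplane (y - q)) /\ controlled T (U :&: hyperplane (y - q)) s.
Proof.
move=> gp [sub att fl sz dU] qT.
have gpy : gen_pos (y :: T ++ s) U.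
  by apply: gen_pos_perm gp; rewrite -cat1s perm_catCA.
have qTs : q \in signed (T ++ s) by apply: signed_sub_mono qT => z zT; rewrite mem_cat zT.
split; first exact: gen_pos_cut gpy qTs.
have sTY : {subset signed T <= signed Y}.
  by apply: signed_sub_mono => z zT; apply: sub; rewrite mem_cat zT.
have yY : y \in signed Y.
  apply/mem_signed; right; exists y; first by apply: sub; rewrite mem_cat inE eqxx orbT.
  by exists false; rewrite scale1r.
split.
- by move=> z; rewrite mem_cat => zT; apply: sub; rewrite mem_cat inE orbCA zT orbT.
- move=> z zY; have [|[p pT zp]] := att z zY; last first.
    by right; exists p => // x; rewrite memv_cap => /andP[xU _]; exact: zp.
  rewrite inE => /orP[/eqP->|]; last by left.
  right; exists q => // x; rewrite memv_cap memv_hyperplane dotBr subr_eq0 => /andP[_ /eqP].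
  exact.
- move=> x v; rewrite !memv_cap !memv_hyperplane => /andP[xU /eqP xyq] vx.
  by rewrite (fl x) //=; apply/eqP/(flat_signed vx yY (sTY _ qT)).
- by move: sz => /=; lia.
- by rewrite (gen_pos_dim gpy qTs) dU; move: sz => /=; lia.
Qed.

(** The next vector y either differs from all signed representatives at x, and
    becomes one, or equals a unique one of them. The cone of x determines which
    case occurs, so the counts add up. *)
Lemma card_stratum s T U : gen_pos (T ++ s) U -> controlled T U s ->
  (cone (arr Y) @` stratum T U #= `I_(flat_ext m (size s) (size T) * DB m k))%card.
Proof.
elim: s T U => [|y s IH] T U gp ctl.
  by apply: card_stratum_leaf => //; rewrite cats0 in gp.
pose N0 := (flat_ext m (size s) (size T).+1 * DB m k)%N.
pose N1 := (flat_ext m (size s) (size T) * DB m k)%N.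
have c0 : (cone (arr Y) @` stratum (y :: T) U #= `I_N0)%card.
  apply: IH; last exact: controlled_rep.
  by apply: gen_pos_perm gp; rewrite -cat1s perm_catCA.
have c1 q : q \in signed T -> (cone (arr Y) @` stratum T (U :&: hyperplane (y - q)) #= `I_N1)%card.
  by move=> qT; have [gpq ctlq] := controlled_attach gp ctl qT; exact: IH.
have [sub _ _ _ _] := ctl.
have sTY : {subset signed T <= signed Y}.
  by apply: signed_sub_mono => z zT; apply: sub; rewrite mem_cat zT.
have yY : y \in signed Y.
  apply/mem_signed; right; exists y; first by apply: sub; rewrite mem_cat inE eqxx orbT.
  by exists false; rewrite scale1r.
pose P (qs : seq V) := stratum (y :: T) U `|`
  [set x | exists2 q, q \in qs & stratum T (U :&: hyperplane (y - q)) x].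
have claim (qs : seq V) : subseq qs (signed T) ->
    (cone (arr Y) @` P qs #= `I_(N0 + size qs * N1))%card.
  elim: qs => [|q qs IHqs] sq.
    rewrite mul0n addn0 (_ : P [::] = stratum (y :: T) U) //.
    by apply/seteqP; split=> x; [case=> // -[]|left].
  have qT : q \in signed T by apply: (mem_subseq sq); rewrite mem_head.
  have -> : P (q :: qs) = P qs `|` stratum T (U :&: hyperplane (y - q)).
    apply/seteqP; split=> x.
      case=> [|[q']]; first by left; left.
      rewrite inE => /orP[/eqP->|q's xq']; first by right.
      by left; right; exists q'.
    case=> [[|[q' q's xq']]|xq]; first by left.
      by right; exists q'; rewrite ?inE ?q's ?orbT.
    by right; exists q; rewrite ?inE ?eqxx.
  rewrite image_setU /= mulSn addnCA addnC; apply: card_disjU.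
  - by apply: IHqs; apply: subseq_trans sq; exact: subseq_cons.
  - exact: c1.
  apply/seteqP; split=> // C [[x Px <-] [x' [xU' reg' _] e]].
  have xyq : dot x (y - q) = 0.
    apply/eqP; rewrite -sgr_eq0 -(cone_signed e yY (sTY _ qT)) sgr_eq0 -memv_hyperplane.
    by move: xU'; rewrite memv_cap => /andP[].
  case: Px => [[_ reg _]|[q' q's [xU reg _]]].
    move: reg; rewrite /regular /= all_cat => /andP[/allP reg _].
    by have := reg _ (map_f (fun q => y - q) qT); rewrite /= xyq eqxx.
  have qq' : q != q'.
    have := subseq_uniq sq (regular_uniq reg).
    by rewrite /= => /andP[+ _]; apply: contraNneq => ->.
  have q'T : q' \in signed T by apply: (mem_subseq sq); rewrite inE q's orbT.
  have := regular_signed reg qT q'T qq'; move: xU xyq; rewrite memv_cap memv_hyperplane !dotBr.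
  by rewrite !subr_eq0 => /andP[_ /eqP->] /eqP; rewrite subr_eq0 => /eqP->; rewrite eqxx.
have -> : stratum T U = P (signed T).
  apply/seteqP; split=> x; last first.
    case=> [[xU reg dx]|[q qT [xU reg dx]]]; split=> //.
      by move: reg; rewrite /regular /= all_cat => /andP[].
    by move: xU; rewrite memv_cap => /andP[].
  move=> [xU reg dx]; case: (boolP (regular (arr (y :: T)) x)) => [|nreg]; first by left.
  right; move: nreg; rewrite /regular /= all_cat negb_and.
  rewrite -[all _ (arr T)]/(regular (arr T) x) reg orbF => /allPn[h /mapP[q qT ->]].
  rewrite negbK => xyq; exists q => //; split=> //.
  by rewrite memv_cap xU memv_hyperplane.
have := claim _ (subseq_refl _); rewrite size_signed /N0 /N1 mulnA -mulnDl addnC.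
by rewrite /= addn1.
Qed.
End Faces.

(** * Chambers and faces of a central arrangement *)

Section Topology.
Variables (R : realType) (d : nat).
Notation V := 'rV[R]_d.
Implicit Types (u v h x y w : V) (a : seq V).

Lemma dot_continuous h : continuous (fun v => dot v h).
Proof.
rewrite /dot; elim: (index_enum _) => [|i r IH].
  rewrite (_ : (fun v => _) = cst 0); first exact: cst_continuous.
  by apply/funext => v; rewrite big_nil.
rewrite (_ : (fun v => _) = (fun v : V => v 0 i * h 0 i) \+
    (fun v : V => \sum_(j <- r) v 0 j * h 0 j)); last first.
  by apply/funext => v; rewrite big_cons.
have ci : continuous (fun v : V => v 0 i * h 0 i).
  move=> x; apply: cvgM; [exact: nbhs_filter | exact: coord_continuous | exact: (@cst_continuous V R (h 0 i) x)].
by move=> x; apply: cvgD; [exact: nbhs_filter | exact: ci | exact: IH].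
Qed.

Lemma line_continuous x w : continuous (fun t : R => x + t *: w).
Proof.
move=> t; apply: cvgD; first exact: cvg_cst.
exact: scalel_continuous.
Qed.

Definition open_cone a x : set V := [set v | forall h, h \in a -> 0 < dot x h * dot v h].

(** The open cone is a union of segments from x that avoid the hyperplanes. In
    the other direction, a normal takes on a connected set an interval of
    values, which cannot contain both signs if it omits 0. *)
Lemma component_regular a x : regular a x ->
  connected_component [set v | regular a v] x = open_cone a x.
Proof.
move=> /allP reg; apply/seteqP; split=> v.
  move=> [B [Bx Bsub Bconn] Bv] h ha.
  have Ih : is_interval ((fun w => dot w h) @` B).
    apply/connected_intervalP/connected_continuous_connected => //.
    exact/continuous_subspaceT/dot_continuous.
  have nz w : B w -> dot w h != 0 by move=> /Bsub /allP; exact.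
  rewrite lt_neqAle eq_sym mulf_neq0 ?nz //= leNgt; apply/negP => xv.
  have [z Bz z0] : ((fun w => dot w h) @` B) 0.
    have Bx' : ((fun w => dot w h) @` B) (dot x h) by exists x.
    have Bv' : ((fun w => dot w h) @` B) (dot v h) by exists v.
    have [x0|x0] : dot x h < 0 \/ 0 < dot x h by apply/orP; rewrite -neq_lt reg.
      by apply: (Ih _ _ Bx' Bv'); rewrite ltW //= ltW // -(nmulr_rlt0 _ x0).
    by apply: (Ih _ _ Bv' Bx'); rewrite -(pmulr_rle0 _ x0) !ltW.
  by have := nz z Bz; rewrite z0 eqxx.
move=> vO; pose S := (fun t : R => x + t *: (v - x)) @` `[0, 1].
apply: (@connected_component_max _ _ S).
- by exists 0; [rewrite /= in_itv /= lexx ler01|rewrite scale0r addr0].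
- move=> _ [t t01 <-]; have {t01} /andP[t0 t1] : 0 <= t <= 1 by move: t01; rewrite /= in_itv.
  apply/allP => h ha; have := vO h ha; rewrite dotDl dotZl dotBl.
  have := reg h ha => xh xv; suff : 0 < dot x h * (dot x h + t * (dot v h - dot x h)).
    by apply: contraTneq => ->; rewrite mulr0 ltxx.
  have xx : 0 < dot x h * dot x h by rewrite -expr2 exprn_even_gt0.
  have -> : dot x h * (dot x h + t * (dot v h - dot x h)) =
      (1 - t) * (dot x h * dot x h) + t * (dot x h * dot v h) by ring.
  case: (eqVneq t 0) => [->|t_neq0]; first by rewrite subr0 mul1r mul0r addr0.
  have t_gt0 : 0 < t by rewrite lt_def t_neq0.
  by apply: ltr_wpDl; [rewrite mulr_ge0 ?subr_ge0 // ltW | exact: mulr_gt0].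
- apply: connected_continuous_connected; first exact: segment_connected.
  exact/continuous_subspaceT/line_continuous.
- by exists 1; [rewrite /= in_itv /= lexx ler01|rewrite scale1r addrC subrK].
Qed.

Definition closed_cone a x : set V := [set v | forall h, h \in a -> 0 <= dot x h * dot v h].

(** A point v of the closed cone is the limit of v + t x for t > 0, which lie in
    the open cone. *)
Lemma closure_open_cone a x : regular a x -> closure (open_cone a x) = closed_cone a x.
Proof.
move=> /allP reg; apply/seteqP; split=> v.
  move=> vcl h ha; pose f (z : V) := dot x h * dot z h.
  have cf : continuous f by move=> z; apply: cvgM;
    [exact: nbhs_filter | exact: (@cst_continuous V R (dot x h) z) | exact: dot_continuous].
  have : closed (f @^-1` [set r | 0 <= r]).
    by have [+ _] := continuous_closedP f => /(_ cf); apply; exact: closed_ge.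
  apply=> B /vcl[w [wO wB]]; exists w; split=> //.
  exact/ltW/wO.
move=> vC B vB; have {}vB : nbhs (v + 0 *: x) B by rewrite scale0r addr0.
have /nbhs_ballP[e /= e0 eB] := @line_continuous v x 0 B vB.
have e2 : 0 < e / 2 by rewrite divr_gt0.
exists (v + (e / 2) *: x); split; last first.
  apply: eB; rewrite /ball /= sub0r normrN gtr0_norm //.
  by rewrite ltr_pdivrMr // ltr_pMr // ltr1n.
move=> h ha; rewrite dotDl dotZl mulrDr.
apply: ltr_wpDl; first exact: vC.
rewrite mulrCA mulr_gt0 // -expr2 exprn_even_gt0 //=; exact: reg.
Qed.
End Topology.

Section Tessellation.
Variables (R : realType) (d : nat).
Notation V := 'rV[R]_d.
Implicit Types (u v h x y w : V) (a : seq V) (W : {vspace V}).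

Lemma closed_cone_regular a x : regular a x -> closed_cone a x = cone a x.
Proof.
move=> /allP reg; apply/seteqP; split=> v vC h ha; have := vC h ha; have := reg h ha;
  rewrite neq_lt => /orP[xh|xh].
- by rewrite nmulr_rge0 // => vh; split=> // x0; move: xh; rewrite ltNge x0.
- by rewrite pmulr_rge0 // => vh; split=> // x0; move: xh; rewrite ltNge x0.
- by case=> _; rewrite nmulr_rge0 //; apply; exact: ltW.
- by case=> + _; rewrite pmulr_rge0 //; apply; exact: ltW.
Qed.

(** Given a point off the hyperplanes of a, move it slightly in the direction of
    the new normal h, which is not orthogonal to itself. *)
Lemma exists_regular a : {in a, forall h, h != 0} -> exists x, regular a x.
Proof.
elim: a => [|h a IH] nz; first by exists 0.
have [g ga|x reg] := IH; first by apply: nz; rewrite inE ga orbT.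
case: (eqVneq (dot x h) 0) => xh; last by exists x; rewrite /regular /= xh.
have [e e0 P] := perturb_regular h reg.
have [] := P e; first by rewrite gtr0_norm.
move=> reg' _; exists (x + e *: h); rewrite /regular /= -/(regular a _) reg' andbT.
rewrite dotDl xh add0r dotZl; apply: mulf_neq0; first by rewrite gt_eqF.
have hn : h != 0 by apply: nz; exact: mem_head.
by apply: contra_neq hn => /dot_self_eq0.
Qed.

(** If v lies in the flat of x, then x + e v lies in the cone of x for small e, so
    the cone spans the flat. *)
Lemma cone_dim a x k : has_dim (cone a x) k <-> \dim (flat a x) = k.
Proof.
have hull : is_linear_hull (cone a x) (flat a x).
  split=> [v vC|W coneW]; last apply/subvP => v /mem_flat vF.
    apply/mem_flat => h ha xh; apply/eqP; rewrite eq_le.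
    by have [] := vC h ha; rewrite xh lexx => -> // ->.
  have [e e0 P] := perturb a x v.
  have xW : x \in W by apply: coneW.
  have : x + e *: v \in W.
    apply: coneW => h ha; have [] := P e _ h ha; first by rewrite gtr0_norm.
    case: (ltrgt0P (dot x h)) => [xh /(_ isT) ev _|xh _ /(_ isT) ev|xh _ _].
    - by split=> // _; exact: ltW.
    - by split=> // _; exact: ltW.
    - by rewrite dotDl dotZl xh vF // mulr0 addr0 lexx.
  by rewrite rpredDl // rpredZeq gt_eqF.
split=> [[U [UC Umin] <-]|<-]; last by exists (flat a x).
case: hull => FC Fmin; congr (\dim _); apply/eqP; rewrite eqEsubv.
by rewrite Fmin ?Umin.
Qed.

(** Adding up points of F, one for each normal not vanishing on F, gives a point
    in the relative interior; the hypothesis forbids cancellation. *)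
Lemma relative_interior_point (F : set V) a :
  F 0 -> (forall x v, F x -> F v -> F (x + v)) ->
  (forall x v h, h \in a -> F x -> F v -> dot (x + v) h = 0 -> dot x h = 0) ->
  exists2 x, F x & forall v h, F v -> h \in a -> dot x h = 0 -> dot v h = 0.
Proof.
move=> F0 FD; elim: a => [|h a IH] sgn; first by exists 0.
have [x v g ga|x Fx xP] := IH; first by apply: sgn; rewrite inE ga orbT.
case: (pselect (exists2 v, F v & dot v h != 0 /\ dot x h = 0)) => [[w Fw [wh xh]]|nw].
  exists (x + w) => [|v g Fv]; first exact: FD.
  rewrite inE => /orP[/eqP-> /eqP|ga xw0]; first by rewrite dotDl xh add0r (negbTE wh).
  by apply: xP => //; apply: sgn xw0 => //; rewrite inE ga orbT.
exists x => // v g Fv; rewrite inE => /orP[/eqP-> xh|]; last exact: xP.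
by apply/eqP/negP => /negP vh; apply: nw; exists v.
Qed.

(** Whatever half-spaces represent the chamber, a face F of it is the cone of any
    point x in its relative interior. If v lies in that cone, then x - e v is
    still in the chamber, so a linear form that is nonnegative on the chamber
    and vanishes at x also vanishes at v. *)
Lemma facesP a k x0 F : {in a, forall h, h != 0} -> regular a x0 ->
  faces k (cone a x0) F -> exists2 x, \dim (flat a x) = k & F = cone a x.
Proof.
move=> nz reg [dimF [m [b [I [bnz Ceq Feq]]]]].
have CE v : cone a x0 v <-> forall i, 0 <= dot v (b i).
  by rewrite Ceq; split=> [vC i|vC i _]; [exact: (vC i)|exact: vC].
have FE v : F v <-> forall i, 0 <= dot v (b i) /\ (i \in I -> dot v (b i) = 0).
  rewrite Feq; split=> [vF i|vF i _]; first have := vF i Logic.I.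
    by case: (i \in I) => [->|]; rewrite ?lexx.
  by have [] := vF i; case: (i \in I) => // _; exact.
have FC v : F v -> cone a x0 v by move=> /FE vF; apply/CE => i; have [] := vF i.
have C0 v h : h \in a -> cone a x0 v -> 0 <= dot x0 h * dot v h.
  by move=> ha; rewrite -closed_cone_regular // => /(_ h ha).
have nz0 h : h \in a -> dot x0 h != 0 by move/allP: reg; exact.
have [|x v Fx Fv|x v h ha /FC xC /FC vC|x Fx xP] := @relative_interior_point F a.
- by apply/FE => i; rewrite dot0l lexx.
- apply/FE => i; have [x1 x2] := (FE x).1 Fx i; have [v1 v2] := (FE v).1 Fv i.
  by rewrite dotDl addr_ge0 //; split=> // iI; rewrite x2 // v2 // addr0.
- have x_ge := C0 x h ha xC; have v_ge := C0 v h ha vC; rewrite dotDl => xv0.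
  have : dot x0 h * dot x h + dot x0 h * dot v h = 0 by rewrite -mulrDr xv0 mulr0.
  move/eqP; rewrite paddr_eq0 // => /andP[+ _].
  by rewrite mulf_eq0 (negbTE (nz0 h ha)) /= => /eqP.
have coneF : F = cone a x.
  apply/seteqP; split=> v vF.
    move=> h ha; have := C0 v h ha (FC v vF); have := C0 x h ha (FC x Fx).
    have := xP v h vF ha; have := nz0 h ha; rewrite neq_lt => /orP[x0h|x0h];
      rewrite ?(nmulr_rge0 _ x0h) ?(pmulr_rge0 _ x0h) => x0v xs vs.
    - split=> // xh; rewrite x0v //; apply/eqP; rewrite eq_le xs; exact: xh.
    - split=> // xh; rewrite x0v //; apply/eqP; rewrite eq_le xs andbT; exact: xh.
  have vC : cone a x0 v.
    rewrite -closed_cone_regular // => h ha; have := C0 x h ha (FC x Fx); have := nz0 h ha.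
    rewrite neq_lt => /orP[x0h|x0h]; rewrite ?(nmulr_rge0 _ x0h) ?(pmulr_rge0 _ x0h).
    - by have [] := vF h ha.
    - by have [] := vF h ha.
  apply/FE => i; split=> [|iI]; first by move/CE: vC.
  have [e e0 P] := perturb a x v.
  have : cone a x0 (x + (- e) *: v).
    rewrite -closed_cone_regular // => h ha; have := C0 x h ha (FC x Fx).
    have [] := P (- e) _ h ha; first by rewrite normrN gtr0_norm.
    have [v1 v2] := vF h ha; have := nz0 h ha.
    case: (ltrgt0P (dot x h)) v1 v2 => [xh|xh|xh] v1 v2 x0n P1 P2.
    - by rewrite pmulr_lge0 // => x0h; rewrite mulr_ge0 // ltW // P1.
    - by rewrite nmulr_lge0 // => x0h; rewrite mulr_le0 // ltW // P2.
    - move=> _; rewrite dotDl dotZl xh (_ : dot v h = 0) ?mulr0 ?addr0 ?mulr0 //.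
      by apply/eqP; rewrite eq_le v1 // v2.
  move/CE => /(_ i); have [_ /(_ iI) xi] := (FE x).1 Fx i.
  have vi : 0 <= dot v (b i) by move/CE: vC.
  rewrite dotDl xi add0r dotZl mulNr oppr_ge0 pmulr_rle0 // => vi'.
  by apply/eqP; rewrite eq_le vi' vi.
exists x => //; apply/cone_dim; by rewrite -coneF.
Qed.

(** Moving x slightly towards a regular point gives a chamber of which the cone of
    x is a face: turn the half-spaces of the normals vanishing at x into
    hyperplanes. *)
Lemma faces_cone a k x : {in a, forall h, h != 0} -> \dim (flat a x) = k ->
  exists2 x0, regular a x0 & faces k (cone a x0) (cone a x).
Proof.
move=> nz dimx; have [w wreg] := exists_regular nz.
have [e e0 P] := perturb a x w; pose x0 := x + e *: w.
have x0P h : h \in a -> (0 < dot x h -> 0 < dot x0 h) /\ (dot x h < 0 -> dot x0 h < 0).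
  by move=> ha; apply: P => //; rewrite gtr0_norm.
have reg : regular a x0.
  apply/allP => h ha; have [P1 P2] := x0P h ha.
  case: (ltrgt0P (dot x h)) => [/P1 xh|/P2 xh|xh].
  - by rewrite gt_eqF.
  - by rewrite lt_eqF.
  rewrite dotDl xh add0r dotZl; apply: mulf_neq0; first by rewrite gt_eqF.
  by move/allP: wreg; exact.
exists x0 => //; split; first exact/cone_dim.
pose g (i : 'I_(size a)) := nth 0 a i.
have ga i : g i \in a by exact: mem_nth.
have gP (Q : V -> Prop) : (forall i, Q (g i)) -> forall h, h \in a -> Q h.
  by move=> Qg h ha; have := Qg (Ordinal (etrans (index_mem h a) ha)); rewrite /g nth_index.
have x0n i : dot x0 (g i) != 0 by move/allP: reg; exact.
exists (size a), (fun i => dot x0 (g i) *: g i), [set i | dot x (g i) == 0]%SET; split.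
- by move=> i; rewrite scaler_eq0 negb_or x0n nz.
- rewrite -closed_cone_regular //; apply/seteqP; split=> v vC.
    by move=> i _; rewrite /halfspace /= dotZr; exact: vC.
  by apply: gP => i; have := vC i Logic.I; rewrite /halfspace /= dotZr.
apply/seteqP; split=> v vC.
  move=> i _; rewrite inE /halfspace /perp; have [v1 v2] := vC _ (ga i).
  have [P1 P2] := x0P _ (ga i); case: (ltrgt0P (dot x (g i))) v1 v2 => [/P1 xg|/P2 xg|_] v1 v2 /=.
  - by rewrite dotZr mulr_ge0 ?v1 // ltW.
  - by rewrite dotZr mulr_le0 ?v2 // ltW.
  - by rewrite dotZr (_ : dot v _ = 0) ?mulr0 //; apply/eqP; rewrite eq_le v1 ?v2.
apply: gP => i; have := vC i Logic.I; rewrite inE /halfspace /perp /=.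
have [P1 P2] := x0P _ (ga i); case: (ltrgt0P (dot x (g i))) => [/P1 xg|/P2 xg|_] /=; rewrite dotZr.
- by rewrite pmulr_rge0.
- by rewrite nmulr_rge0.
- by move/eqP; rewrite mulf_eq0 (negbTE (x0n i)) /= => /eqP->; rewrite lexx.
Qed.

End Tessellation.

(** * The type B tessellation *)

(** A zero normal would not lower the dimension. *)
Lemma gen_pos_arr_neq0 (R : realType) (d : nat) (T : seq 'rV[R]_d) U :
  gen_pos T U -> (0 < \dim U)%N -> {in arr T, forall h, h != 0}.
Proof.
elim: T => // y T IH gp U0 h /=; rewrite mem_cat => /orP[/mapP[q qT ->]|]; last first.
  exact: (IH (gen_pos_drop gp) U0).
have /vspace_proper_hyperplane[u _] : (\dim (U :&: hyperplane (y - q)) < \dim U)%N.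
  by rewrite (gen_pos_dim gp qT); lia.
by apply: contra_neq => ->; rewrite dot0r.
Qed.

(** Indices rather than vectors are compared, so that the arrangement can be
    matched with its definition by pairs i < j. *)
Lemma regular_map (R : realType) (d : nat) (I : eqType) (y : I -> 'rV[R]_d) (l : seq I) x :
  uniq l ->
  regular (arr [seq y i | i <- l]) x <->
  {in l, forall i, dot x (y i) != 0} /\
  {in l &, forall i j, i != j -> dot x (y i + y j) != 0 /\ dot x (y i - y j) != 0}.
Proof.
elim: l => [|i l IH] //= /andP[il ul].
rewrite /regular all_cat -[all _ (arr _)]/(regular (arr [seq y i | i <- l]) x); split.
  move=> /andP[/allP yi /(IH ul)[ne0 neq]].
  have yi0 q : q \in signed [seq y i | i <- l] -> dot x (y i - q) != 0.
    by move=> qT; apply/yi/(map_f (fun q => y i - q)).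
  have yij j : j \in l -> dot x (y i + y j) != 0 /\ dot x (y i - y j) != 0.
    move=> jl; have yj : y j \in signed [seq y i | i <- l].
      by apply/mem_signed; right; exists (y j); [exact: map_f|exists false; rewrite scale1r].
    by split; [rewrite -[y j]opprK; apply/yi0/signedN|exact: yi0].
  split=> [j|j1 j2]; rewrite inE.
    by case/orP=> [/eqP->|/ne0 //]; rewrite -[y i]subr0 yi0 ?signed0.
  move=> /orP[/eqP->|jl1]; rewrite inE => /orP[/eqP->|jl2] jj.
  - by rewrite eqxx in jj.
  - exact: yij.
  - have [+ +] := yij _ jl1; rewrite addrC => ? yd; split=> //.
    by rewrite -opprB dotNr oppr_eq0.
  - exact: neq.
move=> [ne0 neq]; have il0 := mem_head i l.
have sub j : j \in l -> j \in i :: l by rewrite inE => ->; rewrite orbT.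
apply/andP; split; last first.
  by apply/(IH ul); split=> [j /sub/ne0|j1 j2 /sub jl1 /sub jl2]; [|exact: neq].
apply/allP => _ /mapP[q qT ->].
case/mem_signed: qT => [->|[_ /mapP[j jl ->] [b ->]]]; first by rewrite subr0 ne0.
have [yp ym] : dot x (y i + y j) != 0 /\ dot x (y i - y j) != 0.
  by apply: neq => //; [exact: sub|apply: contraNneq il => ->].
by case: b; rewrite ?scale1r // scaleN1r opprK.
Qed.

Lemma weyl_tessellationE (R : realType) (d n : nat) (y : 'I_n -> 'rV[R]_d) :
  let a := arr [seq y i | i <- enum 'I_n] in
  weyl_tessellation y = cone a @` [set x | regular a x].
Proof.
move=> a; rewrite /weyl_tessellation.
have -> : ~` typeB_arrangement y = [set x | regular a x].
  have := @regular_map R d _ y (enum 'I_n) _ (enum_uniq _).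
  move=> regE; apply/seteqP; split=> x.
    move=> xA; apply/regE; split=> [i _|i j _ _ ij].
      by apply/eqP => xi; apply: xA; right; exists i.
    wlog ltij : i j ij / (i < j)%N.
      move=> H; have [/H//|lt_ji|/val_inj eij] := ltngtP i j; first exact.
        have [|] := H j i _ lt_ji; first by rewrite eq_sym.
        rewrite addrC => ? ym; split=> //.
        by rewrite -opprB dotNr oppr_eq0.
      by rewrite eij eqxx in ij.
    by split; apply/eqP => xi; apply: xA; left; exists (i, j) => //; [left|right].
  move=> /regE[ne0 neq] [[[i j] /= ij []]|[i _]]; rewrite /perp /=; apply/eqP.
  - by have [] := neq i j; rewrite ?mem_enum // neq_ltn ij.
  - by have [] := neq i j; rewrite ?mem_enum // neq_ltn ij.
  - by rewrite ne0 ?mem_enum.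
apply: eq_imagel => x reg; rewrite component_regular // closure_open_cone //.
exact: closed_cone_regular.
Qed.

Theorem theorem1p4 (R : realType) (d n : nat) (y : 'I_n -> 'rV[R]_d)
    (hd : (2 <= d)%N) (hy : typeB_general_position y)
    (k : nat) (hk : (1 <= k <= d)%N) :
  (tessellation_faces k y
     #= `I_(typeB_stirling2 n (n - d + k) * DB (n - d + k) k)%N)%card.
Proof.
pose Y := [seq y i | i <- enum 'I_n].
have sY : size Y = n by rewrite /Y (size_map y) size_enum_ord.
have gpY := gen_pos_full hy; have dn := hy.1.
have nz : {in arr Y, forall h, h != 0}.
  by apply: gen_pos_arr_neq0 gpY _; rewrite dim_fullv; lia.
have -> : tessellation_faces k y = cone (arr Y) @` stratum Y k [::] fullv.
  rewrite /tessellation_faces weyl_tessellationE; apply/seteqP; split=> F.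
    move=> [_ [x0 reg <-] /(facesP nz reg)[x dx ->]].
    by exists x => //; split=> //; exact: memvf.
  move=> [x [_ _ dx] <-]; have [x0 reg Fx] := faces_cone nz dx.
  by exists (cone (arr Y) x0) => //; exists x0.
rewrite typeB_stirling2_flat_ext -{1 2 3}sY.
apply: (@card_stratum _ _ Y k _ _ Y [::]) => //; first by rewrite sY.
split=> //=.
- by move=> z zY; left.
- by move=> x v _ _; exact: memvf.
- by rewrite add0n subnn subn0 dim_fullv.
Qed.
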